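(* Assume the leakage condition and that $R_0$ is trace class. For each $\omega\in\Omega$ and $k\ge1$, let $\{u_{k,r}(\omega)\}_{r\in\mathcal R_k(\omega)}$ be an (at most countable) orthonormal family and $\lambda_{k,r}(\omega)\ge0$ with $\Delta_k(\omega)=\sum_r\lambda_{k,r}(\omega)\langle\cdot,u_{k,r}(\omega)\rangle u_{k,r}(\omega)$ in the strong operator topology, and set $\varphi_{k,r}(\omega)=\lambda_{k,r}(\omega)^{1/2}u_{k,r}(\omega)$. Then there is a set $\Omega_0\subseteq\Omega$ with $\nu^{\mathrm{tr}}(\Omega_0)=1$ such that for every $\omega\in\Omega_0$: (1) $R_0=\sum_{k=1}^\infty\Delta_k(\omega)$ in the strong operator topology; (2) for every $x\in H$, $\langle x,R_0x\rangle=\sum_{k=1}^\infty\langle x,\Delta_k(\omega)x\rangle=\sum_{k=1}^\infty\sum_{r\in\mathcal R_k(\omega)}|\langle x,\varphi_{k,r}(\omega)\rangle|^2$, with monotone convergence; (3) the family $\{\varphi_{k,r}(\omega):k\ge1,r\in\mathcal R_k(\omega)\}$ has closed linear span equal to $\overline{\mathrm{ran}}(R_0^{1/2})$ and satisfies $\sum_{k,r}|\langle x,\varphi_{k,r}(\omega)\rangle|^2=\langle x,R_0x\rangle$ for all $x\in H$ (a frame for $\overline{\mathrm{ran}}(R_0^{1/2})$ with frame operator $R_0$). In particular, if $R_0$ is the orthogonal projection onto a closed subspace $K\subseteq H$, then $\{\varphi_{k,r}(\omega)\}$ is a Parseval frame for $K$.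
   Context: Let $H$ be a separable complex Hilbert space, $m\ge2$, $P_1,\dots,P_m$ orthogonal projections on $H$, $R_0\in B(H)_+$, and $H_0=\overline{\mathrm{ran}}(R_0^{1/2})$. Let $\mathcal A=\{1,\dots,m\}$, $\mathcal W$ the set of finite words over $\mathcal A$ (including the empty word $\emptyset$); for nonempty $w=j_1\cdots j_n$, $w^-=j_1\cdots j_{n-1}$, and $wj$ is concatenation. WR energy tree: $R_\emptyset=R_0$, and for $w=j_1\cdots j_n$, $n\ge1$, $R_w=R_{w^-}^{1/2}(I-P_{j_n})R_{w^-}^{1/2}$, $D_w=R_{w^-}^{1/2}P_{j_n}R_{w^-}^{1/2}$. $\Omega=\mathcal A^{\mathbb N}$; for $\omega=(j_1,j_2,\dots)$, $\omega|_n=j_1\cdots j_n$, $\omega|_0=\emptyset$; cylinders $[w]=\{\omega:\omega|_{|w|}=w\}$. $\Delta_k(\omega)=D_{\omega|_k}=R_{\omega|_{k-1}}^{1/2}P_{j_k}R_{\omega|_{k-1}}^{1/2}$. Leakage condition: there is $\alpha>0$ with $\langle v,(\sum_{j=1}^mP_j)v\rangle\ge\alpha\|v\|^2$ for all $v\in H_0$. Trace-biased path measure (when $R_0$ is trace class, so every $R_w$, $D_{wj}$ is trace class): $s^{\mathrm{tr}}_{wj}=\mathrm{tr}(D_{wj})$, $S^{\mathrm{tr}}_w=\sum_js^{\mathrm{tr}}_{wj}$; fix $q\in(0,1)^m$ with $\sum_jq_j=1$; $p^{\mathrm{tr}}(j\mid w)=s^{\mathrm{tr}}_{wj}/S^{\mathrm{tr}}_w$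 if $S^{\mathrm{tr}}_w>0$ and $p^{\mathrm{tr}}(j\mid w)=q_j$ otherwise; $\nu^{\mathrm{tr}}$ is the unique Borel probability measure on $\Omega$ with $\nu^{\mathrm{tr}}([j_1\cdots j_n])=\prod_{i=1}^np^{\mathrm{tr}}(j_i\mid j_1\cdots j_{i-1})$. *)

(* Defs.v *)
From HB Require Import structures.
From mathcomp Require Import all_boot all_order all_algebra.
From mathcomp Require Import all_classical all_reals all_analysis.
From mathcomp Require Import complex.
From Stdlib Require Import ClassicalEpsilon.

Set Implicit Arguments.
Unset Strict Implicit.
Unset Printing Implicit Defensive.

Import Order.TTheory GRing.Theory Num.Theory.
Local Open Scope classical_set_scope.
Local Open Scope ring_scope.

Section Hilbert.
Context {R : realType}.
Local Notation C := (R[i]).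
Context {V : lmodType C} (ip : V -> V -> C).

Definition inner_product_axioms : Prop :=
  [/\ forall (a : C) (x y z : V), ip (a *: x + y) z = a * ip x z + ip y z,
      forall x y, ip x y = conjc (ip y x),
      forall x, 0 <= ip x x
    & forall x, ip x x = 0 -> x = 0].

Definition hnorm (x : V) : R := Num.sqrt (complex.Re (ip x x)).

Definition vcvg (u : nat -> V) (l : V) : Prop :=
  forall e : R, 0 < e -> exists N, forall k, (N <= k)%N -> hnorm (u k - l) < e.

Definition cabs (z : C) : R := ComplexField.Normc.normc z.

Definition ccvg (u : nat -> C) (l : C) : Prop :=
  forall e : R, 0 < e -> exists N, forall k, (N <= k)%N -> cabs (u k - l) < e.

Definition vcauchy (u : nat -> V) : Prop :=
  forall e : R, 0 < e -> exists N, forall k l, (N <= k)%N -> (N <= l)%N ->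
    hnorm (u k - u l) < e.

Definition hclosure (S : set V) : set V :=
  [set x | forall e : R, 0 < e -> exists2 y, S y & hnorm (x - y) < e].

Definition separable_hilbert : Prop :=
  [/\ inner_product_axioms,
      (forall u, vcauchy u -> exists l, vcvg u l)
    & exists d : nat -> V, hclosure (range d) = setT].

Definition lin_span (S : set V) : set V :=
  [set x | exists (n : nat) (c : 'I_n -> C) (v : 'I_n -> V),
             (forall i, S (v i)) /\ x = \sum_(i < n) c i *: v i].

Definition bounded_op (T : V -> V) : Prop :=
  (forall (a : C) x y, T (a *: x + y) = a *: T x + T y) /\
  exists M : R, forall x, hnorm (T x) <= M * hnorm x.

Definition positive_op (T : V -> V) : Prop :=
  bounded_op T /\ forall x, 0 <= ip x (T x).

Definition orth_proj (T : V -> V) : Prop :=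
  [/\ bounded_op T, forall x, T (T x) = T x & forall x y, ip (T x) y = ip x (T y)].

(* the (unique) positive square root T^{1/2} of a positive operator T *)
Definition opsqrt (T : V -> V) : V -> V :=
  epsilon (inhabits id) (fun S => positive_op S /\ forall x, S (S x) = T x).

Definition orthonormal_fin (n : nat) (e : 'I_n -> V) : Prop :=
  forall i j, ip (e i) (e j) = (i == j)%:R.

(* trace of a positive operator: sup over finite orthonormal families of
   sum_i <e_i, T e_i>  (equals sum over any orthonormal basis) *)
Definition optrace (T : V -> V) : \bar R :=
  ereal_sup [set t | exists (n : nat) (e : 'I_n -> V),
     orthonormal_fin e /\ t = (\sum_(i < n) complex.Re (ip (e i) (T (e i))))%:E].

Definition trace_class_pos (T : V -> V) : Prop :=
  positive_op T /\ (optrace T < +oo)%E.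

Definition orthonormal_on (I : set nat) (e : nat -> V) : Prop :=
  forall r s, I r -> I s -> ip (e r) (e s) = (r == s)%:R.

Context {m : nat} (P : 'I_m -> V -> V) (R0 : V -> V).

(* R_w; the word w = j1 ... jn is the list [:: j1; ...; jn] *)
Definition Rw (w : seq 'I_m) : V -> V :=
  foldl (fun Rc j => fun x => opsqrt Rc (opsqrt Rc x - P j (opsqrt Rc x))) R0 w.

Definition Dw (w : seq 'I_m) (j : 'I_m) : V -> V :=
  fun x => opsqrt (Rw w) (P j (opsqrt (Rw w) x)).

Definition leakage : Prop :=
  exists alpha : R, 0 < alpha /\
    forall v, hclosure (range (opsqrt R0)) v ->
      alpha * hnorm v ^+ 2 <= complex.Re (ip v (\sum_(j < m) P j v)).

Definition s_tr (w : seq 'I_m) (j : 'I_m) : R := fine (optrace (Dw w j)).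
Definition S_tr (w : seq 'I_m) : R := \sum_(j < m) s_tr w j.
Definition p_tr (q : 'I_m -> R) (w : seq 'I_m) (j : 'I_m) : R :=
  if 0 < S_tr w then s_tr w j / S_tr w else q j.

Definition cyl_prob (q : 'I_m -> R) (w : seq 'I_m) : R :=
  \prod_(i < size w) p_tr q (take i w) (tnth (in_tuple w) i).

(* Delta_k(omega) = D_{omega|_k}, for k >= 1 *)
Definition Delta (om : nat -> 'I_m) (k : nat) : V -> V :=
  Dw (mkseq om k.-1) (om k.-1).

End Hilbert.

(* Path space Omega = A^N with the sigma-algebra generated by cylinders *)
(* (= Borel sigma-algebra of the product topology).  The alphabet is   *)
(* 'I_n.+2, i.e. of size m = n + 2 >= 2.                               *)
(* 'I_k.+1 is pointed (by 0); this makes nat -> 'I_k.+1 a pointedType *)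
Definition ord_pt (k : nat) : 'I_k.+1 := ord0.
HB.instance Definition _ (k : nat) := isPointed.Build 'I_k.+1 (ord_pt k).

Definition cyl {m : nat} (w : seq 'I_m) : set (nat -> 'I_m) :=
  [set om | mkseq om (size w) = w].

Definition cylinders (n : nat) : set (set (nat -> 'I_n.+2)) :=
  [set @cyl n.+2 w | w in [set: seq 'I_n.+2]].

Definition Omega (n : nat) := g_sigma_algebraType (@cylinders n).

(* Main.v *)
(** A positive operator on a Hilbert space has a positive square root, and any
    positive [S] satisfies [ran S] within the closure of [ran S^2]; hence every
    [R_w^(1/2)] takes its values in [H_0], where the leakage bound applies.
    Along a path the increments telescope, [Delta_1 + ... + Delta_N = R_0 - R_N],
    so everything follows once [tr R_N -> 0] almost surely, because
    [||R_N x|| <= tr R_N * ||x||].  Under the trace-biased measure the expected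
    drop of the trace after the word [w] is [sum_j s_j^2 / S >= S / m], with
    [S = sum_j s_j >= alpha tr R_w] by leakage.  Thus the mean of [tr R_N] decays
    geometrically, and Markov's inequality together with the monotonicity of the
    trace along paths gives the almost sure limit. *)
Require Import Defs.
From HB Require Import structures.
From mathcomp Require Import all_boot all_order all_algebra.
From mathcomp Require Import all_classical all_reals all_analysis.
From mathcomp Require Import complex.
From mathcomp Require Import ring lra.
From Stdlib Require ClassicalEpsilon.

Set Implicit Arguments.
Unset Strict Implicit.
Unset Printing Implicit Defensive.

Import Order.TTheory GRing.Theory Num.Theory.
Local Open Scope classical_set_scope.
Local Open Scope ring_scope.

(** * Elementary inequalities and sums of real numbers *)

(** By the Archimedean property the value would be negative after more than [a 0 / e] steps. This
    replaces a limit argument twice: for squared norms of iterates and for the mean trace. *)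
Lemma no_infinite_descent (R : realType) (a : nat -> R) (e : R) :
  0 < e -> (forall i, 0 <= a i) -> ~ (forall i, a i.+1 <= a i - e).
Proof.
move=> e0 a0 H.
have {}H i : a i <= a 0%N - i%:R * e.
  elim: i => [|i IH]; first by rewrite mul0r subr0.
  by rewrite -natr1; have := H i; lra.
have := H (Num.bound (a 0%N / e)); have := a0 (Num.bound (a 0%N / e)).
have := archi_boundP (divr_ge0 (a0 0%N) (ltW e0)).
by rewrite ltr_pdivrMr// => h1 h2 h3; lra.
Qed.

Lemma discriminant_le (R : realType) (a b c : R) :
  (forall t, 0 <= a + 2 * t * b + t ^+ 2 * c) -> b ^+ 2 <= a * c.
Proof.
move=> H; have a0 : 0 <= a by have := H 0; lra.
have [c0|c0|c0] := ltgtP c 0.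
(* A negative [c] is impossible: adding the values at [t] and [-t] cancels [b], and this [t >= 1] is
   large enough that [a + t^2 c < 0]. *)
- set t := 1 + (1 + a) / - c.
  have tc : t * - c = 1 + a - c by rewrite /t; field; lra.
  have t1 : 1 <= t by rewrite /t lerDl divr_ge0//; lra.
  have := H t; have := H (- t); rewrite sqrrN expr2 => h1 h2.
  have : t * (t * - c) <= a by lra.
  by rewrite tc; nra.
(* For [c > 0] the quadratic is evaluated at its minimum. *)
- have := H (- (b / c)) .
  rewrite sqrrN.
  have -> : a + 2 * - (b / c) * b + (b / c) ^+ 2 * c = (a * c - b ^+ 2) / c
    by field; lra.
  by rewrite pmulr_lge0 ?invr_gt0// subr_ge0.
- rewrite c0 mulr0; have [->|b0] := eqVneq b 0; first by rewrite expr0n.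
  have := H (- ((1 + a) / b)); rewrite c0 mulr0.
  have -> : a + 2 * - ((1 + a) / b) * b + 0 = - a - 2 by field.
  by lra.
Qed.

(** For nonnegative terms the unordered sum is the limit of the partial sums in index order. This
    turns epsilon statements on partial sums into values of [\esum]. *)
Lemma esum_fin_lim (R : realType) (S : set nat) (a : nat -> R) (l : R) :
  (forall r, S r -> 0 <= a r) ->
  (forall e, 0 < e -> exists N, forall k, (N <= k)%N ->
     `|\sum_(0 <= r < k | r \in S) a r - l| < e) ->
  (\esum_(r in S) (a r)%:E = l%:E)%E.
Proof.
move=> a0 h.
have -> : S = [set r | r \in S] by apply/seteqP; split=> r /=; rewrite inE.
rewrite -nneseries_esum => [|r rS]; last by rewrite lee_fin a0// -in_setE.
apply/cvg_lim => //.
rewrite (_ : (fun _ => _) = EFin \o (fun k => \sum_(0 <= r < k | r \in S) a r)).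
  apply: cvg_EFin; first exact: nearW.
  apply/cvgrPdist_lt => e /h[N hN]; exists N => // k /= /hN.
  by rewrite distrC.
by apply/funext => k /=; rewrite sumEFin.
Qed.

(** The sum of squared deviations from the average is nonnegative. *)
Lemma sqr_sum_le (R : realType) (m : nat) (s : 'I_m -> R) : (0 < m)%N ->
  (\sum_j s j) ^+ 2 <= m%:R * \sum_j s j ^+ 2.
Proof.
move=> m0; have mp : 0 < m%:R :> R by rewrite ltr0n.
set t := \sum_j s j; have : 0 <= \sum_j (s j - t / m%:R) ^+ 2.
  by apply: sumr_ge0 => j _; exact: sqr_ge0.
under eq_bigr do rewrite sqrrB.
rewrite big_split /= big_split /= sumr_const card_ord sumrN sumrMnl -mulr_suml -/t.
move: (\sum_(i < m) s i ^+ 2) => q; rewrite -[_ ^+ 2 *+ m]mulr_natl -[_ * _ *+ 2]mulr_natl => h.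
have -> : t ^+ 2 = m%:R * (2 * (t * (t / m%:R)) - m%:R * (t / m%:R) ^+ 2).
  by field; rewrite gt_eqF.
by rewrite ler_pM2l//; lra.
Qed.

(** * Calculus in a complex inner product space *)

Section InnerProduct.
Context {R : realType} {V : lmodType R[i]} {ip : V -> V -> R[i]}.
Context (ipA : inner_product_axioms ip).

Local Notation C := R[i].
Local Notation "a *:r x" := (a%:C%C *: x) (at level 40).
Local Notation rip x y := (complex.Re (ip x y)).
Local Notation hn := (hnorm ip).

Lemma ipDl x y z : ip (x + y) z = ip x z + ip y z.
Proof. by case: ipA => h _ _ _; have := h 1 x y z; rewrite scale1r mul1r. Qed.

Lemma ip0l x : ip 0 x = 0.
Proof. by apply/(addrI (ip 0 x)); rewrite -ipDl !addr0. Qed.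

Lemma ipZl a x y : ip (a *: x) y = a * ip x y.
Proof. by case: ipA => h _ _ _; have := h a x 0 y; rewrite !addr0 ip0l addr0. Qed.

Lemma ipC x y : ip x y = conjc (ip y x).
Proof. by case: ipA. Qed.

Lemma ipDr x y z : ip x (y + z) = ip x y + ip x z.
Proof. by rewrite ipC ipDl rmorphD /= -!ipC. Qed.

Lemma ip0r x : ip x 0 = 0.
Proof. by rewrite ipC ip0l conjc0. Qed.

Lemma ipZr a x y : ip x (a *: y) = conjc a * ip x y.
Proof. by rewrite ipC ipZl rmorphM /= -ipC. Qed.

Lemma ipNl x y : ip (- x) y = - ip x y.
Proof. by rewrite -scaleN1r ipZl mulN1r. Qed.

Lemma ipNr x y : ip x (- y) = - ip x y.
Proof. by rewrite ipC ipNl rmorphN /= -ipC. Qed.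

Lemma ipBl x y z : ip (x - y) z = ip x z - ip y z.
Proof. by rewrite ipDl ipNl. Qed.

Lemma ipBr x y z : ip x (y - z) = ip x y - ip x z.
Proof. by rewrite ipDr ipNr. Qed.

Lemma ip_suml (I : Type) (s : seq I) (p : pred I) (F : I -> V) y :
  ip (\sum_(i <- s | p i) F i) y = \sum_(i <- s | p i) ip (F i) y.
Proof.
by apply: (big_morph (fun x => ip x y)) => [a b|]; rewrite ?ipDl ?ip0l.
Qed.

Lemma ip_sumr (I : Type) (s : seq I) (p : pred I) (F : I -> V) y :
  ip y (\sum_(i <- s | p i) F i) = \sum_(i <- s | p i) ip y (F i).
Proof.
by apply: (big_morph (fun x => ip y x)) => [a b|]; rewrite ?ipDr ?ip0r.
Qed.

Lemma ReD (a b : C) : complex.Re (a + b) = complex.Re a + complex.Re b.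
Proof. by case: a b => ? ? []. Qed.
Lemma ReN (a : C) : complex.Re (- a) = - complex.Re a.
Proof. by case: a. Qed.
Lemma ReZ (a : R) (b : C) : complex.Re (a%:C%C * b) = a * complex.Re b.
Proof. by case: b => ? ? /=; rewrite mul0r subr0. Qed.
Lemma Re_sum (I : Type) (s : seq I) (p : pred I) (F : I -> C) :
  complex.Re (\sum_(i <- s | p i) F i) = \sum_(i <- s | p i) complex.Re (F i).
Proof. by apply: (big_morph _ ReD). Qed.

Lemma ripC x y : rip x y = rip y x.
Proof. by rewrite ipC; case: (ip y x). Qed.
Lemma ripDl x y z : rip (x + y) z = rip x z + rip y z.
Proof. by rewrite ipDl ReD. Qed.
Lemma ripDr x y z : rip x (y + z) = rip x y + rip x z.
Proof. by rewrite ipDr ReD. Qed.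
Lemma ripNl x y : rip (- x) y = - rip x y.
Proof. by rewrite ipNl ReN. Qed.
Lemma ripNr x y : rip x (- y) = - rip x y.
Proof. by rewrite ipNr ReN. Qed.
Lemma ripZl a x y : rip (a *:r x) y = a * rip x y.
Proof. by rewrite ipZl ReZ. Qed.
Lemma ripZr a x y : rip x (a *:r y) = a * rip x y.
Proof. by rewrite ripC ripZl ripC. Qed.
Lemma Im_ip x y : complex.Im (ip x y) = - rip ('i%C *: x) y.
Proof. by rewrite ipZl mulrC ReiNIm opprK. Qed.

Definition ripE := (ripDl, ripDr, ripNl, ripNr, ripZl, ripZr).

Lemma rip_ge0 x : 0 <= rip x x.
Proof. by case: ipA => _ _ h _; have := h x; rewrite lecE => /andP[]. Qed.

Lemma ip_self x : ip x x = (rip x x)%:C%C.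
Proof.
case: ipA => _ _ h _; have := h x; rewrite lecE => /andP[/eqP /= + _].
by case: (ip x x) => a b /= ->.
Qed.

Lemma rip_eq0 x : rip x x = 0 -> x = 0.
Proof. by move=> h; case: ipA => _ _ _; apply; rewrite ip_self h. Qed.

Lemma hnorm_sqr x : hn x ^+ 2 = rip x x.
Proof. by rewrite sqr_sqrtr// rip_ge0. Qed.

Lemma hnorm_ge0 x : 0 <= hn x. Proof. exact: sqrtr_ge0. Qed.

Lemma hnorm0 : hn 0 = 0.
Proof. by rewrite /hnorm ip0l sqrtr0. Qed.

Lemma hnorm_eq0 x : hn x = 0 -> x = 0.
Proof. by move=> h; apply: rip_eq0; rewrite -hnorm_sqr h expr0n. Qed.

Lemma hnormN x : hn (- x) = hn x.
Proof. by rewrite /hnorm ipNl ipNr opprK. Qed.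

Lemma hnormB x y : hn (x - y) = hn (y - x).
Proof. by rewrite -hnormN opprB. Qed.

Lemma hnorm_le x (c : R) : 0 <= c -> (hn x <= c) = (rip x x <= c ^+ 2).
Proof. by move=> c0; rewrite -hnorm_sqr ler_pXn2r// nnegrE hnorm_ge0. Qed.

Lemma hnormZ a x : hn (a *:r x) = `|a| * hn x.
Proof.
by rewrite /hnorm !ripE mulrA -expr2 sqrtrM ?sqr_ge0// sqrtr_sqr.
Qed.

Lemma rip_le_hnorm x y : rip x y <= hn x * hn y.
Proof.
have h : rip x y ^+ 2 <= rip x x * rip y y.
  apply: discriminant_le => t.
  have := rip_ge0 (x + t *:r y); rewrite !ripE (ripC y x).
  by move=> h; lra.
have [/le_trans|r0] := lerP (rip x y) 0.
  by apply; rewrite mulr_ge0// hnorm_ge0.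
rewrite -(@ler_pXn2r _ 2%N)// ?nnegrE ?(ltW r0)// ?mulr_ge0 ?hnorm_ge0//.
by rewrite exprMn !hnorm_sqr.
Qed.

Lemma rip_abs_le x y : `|rip x y| <= hn x * hn y.
Proof.
by rewrite ler_norml rip_le_hnorm lerNl -ripNl -(hnormN x) rip_le_hnorm.
Qed.

Lemma hnormD x y : hn (x + y) <= hn x + hn y.
Proof.
rewrite hnorm_le ?addr_ge0 ?hnorm_ge0// !ripE (ripC y x) -!hnorm_sqr.
by have := rip_le_hnorm x y; lra.
Qed.

Lemma hnorm_dist x y z : hn (x - z) <= hn (x - y) + hn (y - z).
Proof. by rewrite -[x - z](subrKA y) hnormD. Qed.

Lemma vcvg_rip (u : nat -> V) l y : vcvg ip u l ->
  forall e, 0 < e -> exists N, forall k, (N <= k)%N -> `|rip (u k) y - rip l y| < e.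
Proof.
move=> h e e0.
(* The added 1 keeps the divisor positive even for [y = 0]; the same device recurs below. *)
have y0 : 0 < hn y + 1 by rewrite ltr_wpDl// hnorm_ge0.
have [N hN] := h _ (divr_gt0 e0 y0); exists N => k /hN.
rewrite ltr_pdivlMr// => h1.
rewrite -ripNl -ripDl; apply: le_lt_trans (rip_abs_le _ _) _.
by have := hnorm_ge0 (u k - l); lra.
Qed.

Lemma vcvg_unique u l l' : vcvg ip u l -> vcvg ip u l' -> l = l'.
Proof.
move=> h h'; apply/eqP; rewrite -subr_eq0; apply/eqP/hnorm_eq0/eqP.
rewrite eq_le hnorm_ge0 andbT; apply/ler_addgt0Pl => e e0; rewrite addr0.
have e2 : 0 < e / 2 by rewrite divr_gt0.
have [N hN] := h _ e2; have [N' hN'] := h' _ e2.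
have := hN _ (leq_maxl N N'); have := hN' _ (leq_maxr N N').
set k := maxn _ _; have := hnorm_dist l (u k) l'; rewrite (hnormB l (u k)).
lra.
Qed.

Lemma hclosure_incl (S : set V) : S `<=` hclosure ip S.
Proof. by move=> x Sx e e0; exists x => //; rewrite subrr hnorm0. Qed.

Lemma hclosure_sub (S T : set V) : S `<=` hclosure ip T ->
  hclosure ip S `<=` hclosure ip T.
Proof.
move=> h x hx e e0; have e2 : 0 < e / 2 by rewrite divr_gt0.
have [y Sy xy] := hx _ e2; have [z Tz yz] := h _ Sy _ e2.
by exists z => //; have := hnorm_dist x y z; lra.
Qed.

Lemma hclosure_vcvg (S : set V) u l :
  (forall n, S (u n)) -> vcvg ip u l -> hclosure ip S l.
Proof.
move=> h c e /c[N hN]; exists (u N) => //; rewrite hnormB; exact: hN.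
Qed.

(** * Bounded linear operators *)

Section LinearOperators.
Context {T : V -> V} (bT : bounded_op ip T).

Lemma opD x y : T (x + y) = T x + T y.
Proof. by case: bT => h _; have := h 1 x y; rewrite !scale1r. Qed.
Lemma op0 : T 0 = 0.
Proof. by apply/(addrI (T 0)); rewrite -opD !addr0. Qed.
Lemma opZ a x : T (a *: x) = a *: T x.
Proof. by case: bT => h _; have := h a x 0; rewrite op0 !addr0. Qed.
Lemma opN x : T (- x) = - T x.
Proof. by rewrite -scaleN1r opZ scaleN1r. Qed.
Lemma opB x y : T (x - y) = T x - T y.
Proof. by rewrite opD opN. Qed.
Lemma op_sum (I : Type) (s : seq I) (p : pred I) (F : I -> V) :
  T (\sum_(i <- s | p i) F i) = \sum_(i <- s | p i) T (F i).
Proof. exact: (big_morph T opD op0). Qed.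

Lemma op_bound : exists2 c, 0 < c & forall x, hn (T x) <= c * hn x.
Proof.
case: bT => _ [M h]; exists (`|M| + 1); first by rewrite ltr_wpDl.
move=> x; apply: le_trans (h x) _; apply: ler_wpM2r; first exact: hnorm_ge0.
by have := ler_norm M; lra.
Qed.
End LinearOperators.

Lemma bounded_op_comp T S : bounded_op ip T -> bounded_op ip S ->
  bounded_op ip (T \o S).
Proof.
move=> bT bS; split=> [a x y|]; first by rewrite /= (opD bS) (opZ bS) (opD bT) (opZ bT).
have [c c0 hc] := op_bound bT; have [d d0 hd] := op_bound bS.
exists (c * d) => x; apply: le_trans (hc _) _.
by rewrite -mulrA ler_pM2l.
Qed.

Lemma bounded_op_sub T S : bounded_op ip T -> bounded_op ip S ->
  bounded_op ip (fun x => T x - S x).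
Proof.
move=> bT bS; split=> [a x y|].
  by rewrite (opD bS) (opZ bS) (opD bT) (opZ bT) scalerBr opprD addrACA.
have [c c0 hc] := op_bound bT; have [d d0 hd] := op_bound bS.
exists (c + d) => x.
apply: le_trans (hnormD _ _) _; rewrite hnormN mulrDl.
exact: lerD.
Qed.

Lemma bounded_op_scale a T : bounded_op ip T -> bounded_op ip (fun x => a *:r T x).
Proof.
move=> bT; split=> [b x y|].
  by rewrite (opD bT) (opZ bT) scalerDr !scalerA mulrC.
have [c c0 hc] := op_bound bT; exists (`|a| * c) => x.
by rewrite hnormZ -mulrA ler_wpM2l.
Qed.

Lemma bounded_op_id : bounded_op ip id.
Proof. by split=> //; exists 1 => x; rewrite mul1r. Qed.

(* Over the complex numbers a nonnegative quadratic form forces symmetry, by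
   polarisation; this reduces positivity to the real inner product. *)
Lemma positive_op_ripP T : positive_op ip T <->
  [/\ bounded_op ip T, forall x y, rip (T x) y = rip x (T y)
    & forall x, 0 <= rip x (T x)].
Proof.
split=> [[bT pT]|[bT sT pT]].
  have re z : ip z (T z) = ip (T z) z.
    rewrite [RHS]ipC; have := pT z; rewrite lecE => /andP[/eqP /= + _].
    by case: (ip z (T z)) => a b /= ->; rewrite oppr0.
  split=> // [x y|x]; last by have := pT x; rewrite lecE => /andP[].
  suff -> : ip (T x) y = ip x (T y) by [].
  (* The identity [re] at these two vectors gives linear equations in the real and imaginary parts
     of the mixed products. *)
  have h1 := re (x + y); have h2 := re (x + 'i%C *: y).
  move: h1 h2; rewrite !(opD bT) !(opZ bT) !ipDl !ipDr !ipZl !ipZr !(re x) !(re y).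
  move: (ip x (T y)) (ip y (T x)) (ip (T x) y) (ip (T y) x) (ip (T x) x) (ip (T y) y).
  move=> [a1 a2] [b1 b2] [c1 c2] [d1 d2] [e1 e2] [f1 f2] /= [h1 h2] [h3 h4].
  by apply/eqP; rewrite eq_complex /=; apply/andP; split; apply/eqP; lra.
split=> // x; rewrite lecE pT andbT /= Im_ip.
(* Moving [T] across by symmetry and then the factor [i] changes the sign, so this number equals its
   own negative. *)
have : rip ('i%C *: x) (T x) = 0.
  rewrite -sT (opZ bT).
  have h : rip ('i%C *: T x) x = - rip ('i%C *: x) (T x).
    by rewrite !ipZl (ipC (T x)); case: (ip x (T x)) => a b /=; ring.
  by have := sT ('i%C *: x) x; rewrite (opZ bT) h; lra.
by move=> ->; rewrite oppr0.
Qed.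

(** * The quadratic form and the range of a positive operator *)

Section Positive.
Context {T : V -> V} (pT : positive_op ip T).
Let bT : bounded_op ip T. Proof. by case/positive_op_ripP: pT. Qed.
Let sT : forall x y, rip (T x) y = rip x (T y).
Proof. by case/positive_op_ripP: pT. Qed.
Let rT : forall x, 0 <= rip x (T x).
Proof. by case/positive_op_ripP: pT. Qed.

Lemma positive_ip x : ip x (T x) = (rip x (T x))%:C%C.
Proof.
case: pT => _ /(_ x); rewrite lecE => /andP[/eqP /= + _].
by case: (ip x (T x)) => a b /= ->.
Qed.

(** Cauchy-Schwarz for the semi-inner product defined by [T]: its form at [x + t y] is a nonnegative
    quadratic in [t]. *)
Lemma positive_CS x y : rip x (T y) ^+ 2 <= rip x (T x) * rip y (T y).
Proof.
apply: discriminant_le => t.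
have := rT (x + t *:r y).
rewrite (opD bT) (opZ bT) !ripE -(sT y x) (ripC (T y) x); lra.
Qed.

(** This is [T <= c] implying [T^2 <= c T]. Cauchy-Schwarz for the pair [T x], [x] bounds
    [||T x||^4] by [c ||T x||^2 <x, T x>], and one factor [||T x||^2] cancels. *)
Lemma positive_form_bound c :
  (forall x, rip x (T x) <= c * rip x x) ->
  forall x, rip (T x) (T x) <= c * rip x (T x).
Proof.
move=> h x; have := positive_CS (T x) x; have := h (T x).
have := rT (T x); have := rT x.
have := rip_ge0 (T x).
set a := rip (T x) (T x); set b := rip x (T x); set d := rip (T x) _.
move=> a0 b0 d0 h1 h2.
have [<-|an0] := eqVneq 0 a.
  have := h x; rewrite -/b => h3.
  have [c0|c0] := lerP 0 c; first by rewrite mulr_ge0.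
  have := rip_ge0 x; nra.
have : a ^+ 2 <= c * b * a.
  by apply: le_trans h2 _; rewrite mulrAC ler_wpM2r.
by rewrite expr2 ler_pM2r// lt_neqAle an0.
Qed.

Lemma positive_norm_bound c : 0 <= c ->
  (forall x, hn (T x) <= c * hn x) -> forall x, rip (T x) (T x) <= c * rip x (T x).
Proof.
move=> c0 h; apply: positive_form_bound => x.
apply: le_trans (rip_le_hnorm _ _) _.
by rewrite -hnorm_sqr expr2 mulrCA ler_wpM2l// hnorm_ge0.
Qed.

(* The iterates y' = y - T y / c stay in x + ran T, and ||y||^2 drops by at
   least ||T y||^2 / c^2 at each step, so T y becomes arbitrarily small. *)
Lemma range_sub_closure_range_sqr x : hclosure ip (range (T \o T)) (T x).
Proof.
have [c c0 hc] := op_bound bT.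
have hp := positive_norm_bound (ltW c0) hc.
move=> e e0.
pose y := fix y i := if i is j.+1 then y j - c^-1 *:r T (y j) else x.
have hy i : exists z, x - y i = T z.
  elim: i => [|i [z hz]]; first by exists 0; rewrite subrr (op0 bT).
  exists (z + c^-1 *:r y i); rewrite (opD bT) (opZ bT) -hz /=.
  by rewrite opprD opprK addrA.
have [[i hi]|no] := EM (exists i, hn (T (y i)) < e).
  have [z hz] := hy i; exists (T (T z)); first by exists z.
  by rewrite -hz (opB bT) subKr.
exfalso; apply: (@no_infinite_descent R (fun i => rip (y i) (y i)) ((e / c) ^+ 2)).
- by rewrite exprn_gt0// divr_gt0.
- by move=> i; exact: rip_ge0.
move=> i /=; rewrite !ripE (ripC (T _) (y i)).
have ge : e ^+ 2 <= rip (T (y i)) (T (y i)).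
  rewrite -hnorm_sqr ler_pXn2r// ?nnegrE ?hnorm_ge0 ?(ltW e0)//.
  by rewrite leNgt; apply/negP => h; apply: no; exists i.
(* Since [||T y||^2 <= c <y, T y>], the cross term [-(2/c) <y, T y>] is at least twice as large in
   size as the quadratic term [||T y||^2 / c^2]. *)
have := hp (y i).
move: ge; set a := rip (y i) (T (y i)); set b := rip (T (y i)) (T (y i)) => ge h1.
have : c^-1 * (c^-1 * b) <= c^-1 * a.
  by rewrite ler_pM2l ?invr_gt0// mulrC ler_pdivrMr// mulrC.
have : c^-1 * (c^-1 * e ^+ 2) <= c^-1 * (c^-1 * b).
  by rewrite !ler_pM2l ?invr_gt0.
rewrite (_ : (e / c) ^+ 2 = c^-1 * (c^-1 * e ^+ 2)); first lra.
by rewrite exprMn; ring.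
Qed.

End Positive.

(** * The iteration for the square root *)

(** Iteration for the fixed point 1 of [t = (1 + t^2) / 2]. Being monotone and bounded it is Cauchy,
    and this transfers to the operator iterates. *)
Fixpoint sqrt_scal (n : nat) : R :=
  if n is k.+1 then (1 + sqrt_scal k ^+ 2) / 2 else 0.

Lemma sqrt_scal_ge0 n : 0 <= sqrt_scal n.
Proof. by elim: n => //= n IH; rewrite divr_ge0// addr_ge0// sqr_ge0. Qed.

Lemma sqrt_scal_le1 n : sqrt_scal n <= 1.
Proof. by elim: n => //= n IH; have := sqrt_scal_ge0 n; nra. Qed.

Lemma sqrt_scal_nd n : sqrt_scal n <= sqrt_scal n.+1.
Proof. by rewrite /=; have := sqr_ge0 (sqrt_scal n - 1); lra. Qed.

Lemma sqrt_scal_homo n k : (n <= k)%N -> sqrt_scal n <= sqrt_scal k.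
Proof. exact: (homo_leq _ le_trans sqrt_scal_nd). Qed.

Lemma sqrt_scal_cauchy (e : R) : 0 < e ->
  exists N, forall k, (N <= k)%N -> sqrt_scal k - sqrt_scal N < e.
Proof.
move=> e0.
have hs : has_sup (range sqrt_scal).
  by split; [exists 0, 0%N | exists 1 => _ [n _ <-]; exact: sqrt_scal_le1].
have [_ [N _ <-] hN] := sup_adherent e0 hs; exists N => k _.
have : sqrt_scal k <= sup (range sqrt_scal) by apply: ub_le_sup; [case: hs|exists k].
by lra.
Qed.

Lemma sqrt_scalS n : sqrt_scal n.+1 = (1 + sqrt_scal n ^+ 2) / 2.
Proof. by []. Qed.

Section SquareRootIteration.
Context (B : V -> V) (bB : bounded_op ip B) (B1 : forall x, hn (B x) <= hn x).
Context (sB : forall x y, rip (B x) y = rip x (B y)).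

(* The limit Y solves Y = (B + Y^2)/2, so that (1 - Y)^2 = 1 - B; the scalar
   recursion [sqrt_scal] (the case B = 1) majorises the norms of the increments. *)
Fixpoint sqrt_iter (n : nat) (x : V) : V :=
  if n is k.+1 then 2^-1 *:r (B x + sqrt_iter k (sqrt_iter k x)) else 0.

Lemma sqrt_iter_bounded n : bounded_op ip (sqrt_iter n).
Proof.
elim: n => [|n IH]; first by split=> [a x y|]; [rewrite /= scaler0 addr0|
  exists 0 => x; rewrite /= hnorm0 mul0r].
apply: bounded_op_scale.
have := bounded_op_sub bB (bounded_op_scale (-1) (bounded_op_comp IH IH)).
congr (bounded_op ip _); apply/funext => x /=.
by rewrite rmorphN1 scaleN1r opprK.
Qed.

Lemma sqrt_iter_commB n x : sqrt_iter n (B x) = B (sqrt_iter n x).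
Proof.
elim: n x => [|n IH] x /=; first by rewrite (op0 bB).
by rewrite !IH (opZ bB) (opD bB).
Qed.

(** All iterates are polynomials in [B]. *)
Lemma sqrt_iter_comm n k x :
  sqrt_iter n (sqrt_iter k x) = sqrt_iter k (sqrt_iter n x).
Proof.
have bk := sqrt_iter_bounded k.
elim: n x => [|n IH] x /=; first by rewrite (op0 bk).
by rewrite !IH (opZ bk) (opD bk) sqrt_iter_commB.
Qed.

Lemma sqrt_iter_sym n x y : rip (sqrt_iter n x) y = rip x (sqrt_iter n y).
Proof.
elim: n x y => [|n IH] x y /=; first by rewrite ip0l ip0r.
by rewrite !ripE !IH sB.
Qed.

Lemma sqrt_iter_norm n x : hn (sqrt_iter n x) <= sqrt_scal n * hn x.
Proof.
elim: n x => [|n IH] x /=; first by rewrite hnorm0 mul0r.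
rewrite hnormZ ger0_norm ?invr_ge0//.
rewrite mulrAC [leRHS]mulrC ler_pM2l ?invr_gt0// mulrDl mul1r.
apply: le_trans (hnormD _ _) _; apply: lerD (B1 x) _.
apply: le_trans (IH _) _; rewrite expr2 -mulrA ler_wpM2l//; exact: sqrt_scal_ge0.
Qed.

(** As the iterates commute, the difference of their squares factors as sum times difference. The
    scalar sequence satisfies the same recursion with equality, so the bound propagates. *)
Lemma sqrt_iter_step n x :
  hn (sqrt_iter n.+1 x - sqrt_iter n x) <= (sqrt_scal n.+1 - sqrt_scal n) * hn x.
Proof.
elim: n x => [|n IH] x.
  by rewrite /sqrt_scal !subr0; apply: (sqrt_iter_norm 1).
set d := sqrt_iter n.+1 x - sqrt_iter n x.
have -> : sqrt_iter n.+2 x - sqrt_iter n.+1 x =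
    2^-1 *:r (sqrt_iter n.+1 d + sqrt_iter n d).
  rewrite /d (opB (sqrt_iter_bounded n.+1)) (opB (sqrt_iter_bounded n)).
  rewrite (sqrt_iter_comm n.+1 n) subrKA.
  rewrite [sqrt_iter n.+2 x]/= [in X in _ - X]/= -scalerBr; congr (_ *: _).
  by rewrite opprD addrACA subrr add0r.
rewrite hnormZ ger0_norm ?invr_ge0//.
have h1 := sqrt_iter_norm n.+1 d; have h2 := sqrt_iter_norm n d.
have h3 := IH x; rewrite -/d in h3.
have h4 := hnormD (sqrt_iter n.+1 d) (sqrt_iter n d).
have -> : sqrt_scal n.+2 - sqrt_scal n.+1 =
    2^-1 * ((sqrt_scal n.+1 + sqrt_scal n) * (sqrt_scal n.+1 - sqrt_scal n)).
  rewrite [X in X - _ = _]sqrt_scalS [X in _ - X = _]sqrt_scalS.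
  by move: (sqrt_scal n.+1) (sqrt_scal n) => a b; field.
rewrite -mulrA ler_pM2l// -mulrA.
apply: le_trans (ler_wpM2l _ h3); first by rewrite mulrDl; lra.
by rewrite addr_ge0// sqrt_scal_ge0.
Qed.

Lemma sqrt_iter_dist n k x : (n <= k)%N ->
  hn (sqrt_iter k x - sqrt_iter n x) <= (sqrt_scal k - sqrt_scal n) * hn x.
Proof.
move=> /subnK <-; elim: (k - n)%N => [|i IH]; first by rewrite !subrr hnorm0 mul0r.
rewrite addSn; apply: le_trans (hnorm_dist _ (sqrt_iter (i + n) x) _) _.
have := sqrt_iter_step (i + n) x; move: (sqrt_scal (i + n).+1) => t; nra.
Qed.

Lemma sqrt_iter_cauchy x : vcauchy ip (sqrt_iter ^~ x).
Proof.
move=> e e0; have x0 : 0 < hn x + 1 by rewrite ltr_wpDl// hnorm_ge0.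
have [N hN] := sqrt_scal_cauchy (divr_gt0 (divr_gt0 e0 (ltr0Sn _ 1)) x0).
have {}hN k : (N <= k)%N -> hn (sqrt_iter k x - sqrt_iter N x) < e / 2.
  move=> Nk; apply: le_lt_trans (sqrt_iter_dist x Nk) _.
  have := hN _ Nk; rewrite ltr_pdivlMr//.
  have := sqrt_scal_homo Nk; have := hnorm_ge0 x; nra.
exists N => k l /hN h1 /hN; rewrite hnormB => h2.
by have := hnorm_dist (sqrt_iter k x) (sqrt_iter N x) (sqrt_iter l x); lra.
Qed.

End SquareRootIteration.

(** * Limits of vector sequences *)

Lemma vcvgD u v a b : vcvg ip u a -> vcvg ip v b ->
  vcvg ip (fun n => u n + v n) (a + b).
Proof.
move=> hu hv e e0; have e2 : 0 < e / 2 by rewrite divr_gt0.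
have [N hN] := hu _ e2; have [M hM] := hv _ e2.
exists (maxn N M) => k; rewrite geq_max => /andP[/hN h1 /hM h2].
rewrite opprD addrACA; have := hnormD (u k - a) (v k - b); lra.
Qed.

(** Split [T_n u_n - b] as [T_n (u_n - a) + (T_n a - b)]. This permits the limit in the composition
    of an iterate with itself. *)
Lemma vcvg_contraction (T : nat -> V -> V) u a b :
  (forall n, bounded_op ip (T n)) -> (forall n x, hn (T n x) <= hn x) ->
  vcvg ip u a -> vcvg ip (T ^~ a) b -> vcvg ip (fun n => T n (u n)) b.
Proof.
move=> bT T1 hu hT e e0; have e2 : 0 < e / 2 by rewrite divr_gt0.
have [N hN] := hu _ e2; have [M hM] := hT _ e2.
exists (maxn N M) => k; rewrite geq_max => /andP[/hN h1 /hM h2].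
have := hnorm_dist (T k (u k)) (T k a) b; rewrite -(opB (bT k)).
by have := T1 k (u k - a); lra.
Qed.

Lemma hnormZc c x : hn (c *: x) = cabs c * hn x.
Proof.
rewrite /hnorm ipZl ipZr mulrA ip_self /cabs.
case: (c) => s t /=; rewrite -sqrtrM ?addr_ge0 ?sqr_ge0//; congr Num.sqrt; ring.
Qed.

Lemma vcvgZ c u a : vcvg ip u a -> vcvg ip (fun n => c *: u n) (c *: a).
Proof.
have [->|c0] := eqVneq c 0.
  by move=> _ e e0; exists 0%N => k _; rewrite !scale0r subrr hnorm0.
have cp : 0 < cabs c.
  rewrite lt_neqAle /cabs; apply/andP; split; last by case: (c) => ? ?; exact: sqrtr_ge0.
  by apply: contra c0 => /eqP/esym/ComplexField.Normc.eq0_normc ->.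
move=> h e e0; have [N hN] := h _ (divr_gt0 e0 cp).
by exists N => k /hN; rewrite ltr_pdivlMr// -scalerBr hnormZc [cabs c * _]mulrC.
Qed.

Lemma vcvg_cst a : vcvg ip (fun=> a) a.
Proof. by move=> e e0; exists 0%N => k _; rewrite subrr hnorm0. Qed.

Lemma vcvg_hnorm_le u a c : vcvg ip u a -> (forall n, hn (u n) <= c) -> hn a <= c.
Proof.
move=> h hc; apply/ler_addgt0Pl => e e0.
have [N /(_ _ (leqnn N)) hN] := h _ e0; rewrite hnormB in hN.
have := hnormD (a - u N) (u N); rewrite subrK; have := hc N; lra.
Qed.

Lemma vcvg_rip_eq u v a b x y : vcvg ip u a -> vcvg ip v b ->
  (forall n, rip (u n) x = rip (v n) y) -> rip a x = rip b y.
Proof.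
move=> ha hb h; apply/eqP; rewrite -subr_eq0 -normr_le0; apply/ler_addgt0Pl => e e0.
have e2 : 0 < e / 2 by rewrite divr_gt0.
have [N hN] := vcvg_rip x ha e2; have [M hM] := vcvg_rip y hb e2.
have := hN _ (leq_maxl N M); have := hM _ (leq_maxr N M).
set k := maxn _ _; rewrite h => h1 h2.
have := ler_distD (rip (v k) y) (rip a x) (rip b y).
rewrite (distrC (rip a x) (rip (v k) y)); lra.
Qed.

(** * Existence of positive square roots *)

Section Complete.
Context (cV : forall u, vcauchy ip u -> exists l, vcvg ip u l).

(** With [||T x|| <= c ||x||] and [B = 1 - T/c], the limit [Y] of the iterates satisfies
    [Y^2 = 2 Y - B]. Hence [(1 - Y)^2 = T/c], and [sqrt c (1 - Y)] is a root, positive because [Y]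
    is a symmetric contraction. *)
Lemma positive_sqrt_exists T : positive_op ip T ->
  exists S, positive_op ip S /\ forall x, S (S x) = T x.
Proof.
move=> pT; have [bT sT rT] := (positive_op_ripP T).1 pT.
have [c c0 hc] := op_bound bT.
have hp := positive_norm_bound pT (ltW c0) hc.
pose B x := x - c^-1 *:r T x.
have bB : bounded_op ip B by apply: bounded_op_sub bounded_op_id (bounded_op_scale _ bT).
have sB x y : rip (B x) y = rip x (B y) by rewrite /B !ripE sT.
(* Expand [||x - T x / c||^2] and use [||T x||^2 <= c <x, T x>]. *)
have B1 x : hn (B x) <= hn x.
  rewrite hnorm_le ?hnorm_ge0// hnorm_sqr /B !ripE (ripC (T x) x).
  have : c^-1 * (c^-1 * rip (T x) (T x)) <= c^-1 * rip x (T x).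
    by rewrite ler_pM2l ?invr_gt0// mulrC ler_pdivrMr// mulrC.
  have : 0 <= c^-1 * rip x (T x) by rewrite mulr_ge0// invr_ge0 ltW.
  lra.
have bY := sqrt_iter_bounded bB.
have Y1 n x : hn (sqrt_iter B n x) <= hn x.
  apply: le_trans (sqrt_iter_norm B1 n x) _.
  by rewrite ler_piMl ?hnorm_ge0// sqrt_scal_le1.
have [Y hY] := choice (fun x => cV (sqrt_iter_cauchy bB B1 x)).
have linY a x y : Y (a *: x + y) = a *: Y x + Y y.
  apply: vcvg_unique (hY _) _.
  rewrite (_ : _ ^~ _ = fun n => a *: sqrt_iter B n x + sqrt_iter B n y).
    exact: vcvgD (vcvgZ a (hY x)) (hY y).
  by apply/funext => n; rewrite (opD (bY n)) (opZ (bY n)).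
(* The fixed point equation is the limit of the recursion: the shifted sequence has the same
   limit. *)
have YY x : Y x = 2^-1 *:r (B x + Y (Y x)).
  apply: (@vcvg_unique (fun n => sqrt_iter B n.+1 x)).
    by move=> e /(hY x)[N hN]; exists N => k Nk; apply: hN; apply: leqW.
  apply: vcvgZ; apply: vcvgD (vcvg_cst _) _.
  exact: vcvg_contraction bY Y1 (hY x) (hY (Y x)).
have Yn x : hn (Y x) <= hn x by apply: vcvg_hnorm_le (hY x) _ => n; exact: Y1.
have bYY : bounded_op ip Y by split=> //; exists 1 => x; rewrite mul1r.
have sY x y : rip (Y x) y = rip x (Y y).
  rewrite [RHS]ripC; apply: vcvg_rip_eq (hY x) (hY y) _ => n.
  by rewrite (sqrt_iter_sym sB) ripC.
exists (fun x => Num.sqrt c *:r (x - Y x)); split.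
  apply/positive_op_ripP; split.
  - by apply: bounded_op_scale; apply: bounded_op_sub bounded_op_id _.
  - by move=> x y; rewrite !ripE sY.
  - move=> x; rewrite ripZr mulr_ge0 ?sqrtr_ge0// !ripE subr_ge0.
    apply: le_trans (rip_le_hnorm _ _) _; rewrite -hnorm_sqr expr2.
    by rewrite ler_wpM2l ?hnorm_ge0.
move=> x; rewrite (opZ bYY) -scalerBr scalerA -rmorphM -expr2 sqr_sqrtr ?(ltW c0)//.
have h2 : (2%:R : R)%:C%C *: Y x = B x + Y (Y x).
  rewrite {1}YY scalerA -rmorphM mulfV ?pnatr_eq0// scale1r //.
have h3 : Y (Y x) = Y x + Y x - B x.
  rewrite -[Y x + Y x]/(Y x *+ 2) -scaler_nat -(rmorph_nat (real_complex R)) h2.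
  by rewrite [B x + _]addrC addrK.
rewrite (opB bYY) h3 /B.
rewrite (_ : _ - _ = c^-1 *:r T x); last first.
  by rewrite opprB (addrAC _ (- (x - _))) addrK subrKA subKr.
by rewrite scalerA -rmorphM mulfV ?gt_eqF// scale1r.
Qed.

(** Existence guarantees that the operator picked by [epsilon] is a root; later arguments handle it
    through these two properties. *)
Lemma opsqrtP T : positive_op ip T ->
  positive_op ip (opsqrt ip T) /\ forall x, opsqrt ip T (opsqrt ip T x) = T x.
Proof.
by move=> /positive_sqrt_exists h; exact: (ClassicalEpsilon.epsilon_spec (inhabits id) _ h).
Qed.

(** * Finite orthonormal lists *)

(** Lists stand in for the indexed families of [optrace] because they are easily extended by a
    vector and concatenated. *)
Definition ortho_seq (s : seq V) : Prop :=
  uniq s /\ forall a b, a \in s -> b \in s -> ip a b = (a == b)%:R.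

(** For orthonormal [s] this is the orthogonal projection onto its span, so [oproj s x = x]
    expresses that [x] lies in the span. *)
Definition oproj (s : seq V) (x : V) : V := \sum_(a <- s) ip x a *: a.

Lemma oproj_sum (I : Type) (l : seq I) (F : I -> V) s :
  oproj s (\sum_(i <- l) F i) = \sum_(i <- l) oproj s (F i).
Proof.
rewrite exchange_big; apply: eq_bigr => a _ /=.
by rewrite ip_suml scaler_suml.
Qed.

Lemma oprojZ c s x : oproj s (c *: x) = c *: oproj s x.
Proof. by rewrite scaler_sumr; apply: eq_bigr => a _; rewrite ipZl scalerA. Qed.

Lemma ip_oproj s x a : ortho_seq s -> a \in s -> ip (oproj s x) a = ip x a.
Proof.
move=> [us os] sa; rewrite ip_suml (bigD1_seq a)//= ipZl (os a a)// eqxx mulr1.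
rewrite big_seq_cond big1 ?addr0// => b /andP[sb ba].
by rewrite ipZl (os b a)// (negbTE ba) mulr0.
Qed.

Lemma oproj_id s a : ortho_seq s -> a \in s -> oproj s a = a.
Proof.
move=> [us os] sa; rewrite /oproj (bigD1_seq a)//= (os a a)// eqxx scale1r.
rewrite big_seq_cond big1 ?addr0// => b /andP[sb ba].
by rewrite os// eq_sym (negbTE ba) scale0r.
Qed.

Lemma ortho_seq_cons e s : ortho_seq s -> ip e e = 1 ->
  (forall a, a \in s -> ip e a = 0) -> ortho_seq (e :: s).
Proof.
move=> [us os] ee ea.
have es : e \notin s.
  by apply/negP => /ea; rewrite ee => /eqP; rewrite oner_eq0.
split=> /=; first by rewrite es.
move=> a b; rewrite !inE => /orP[/eqP->|sa] /orP[/eqP->|sb].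
- by rewrite eqxx.
- by rewrite ea// (_ : e == b = false)//; apply: contraNF es => /eqP->.
- rewrite ipC ea// conjc0 (_ : a == e = false)//.
  by apply: contraNF es => /eqP<-.
- exact: os.
Qed.

Lemma unit_vector z : z != 0 -> ip ((hn z)^-1 *:r z) ((hn z)^-1 *:r z) = 1.
Proof.
move=> z0; have hz : hn z != 0 by apply: contra z0 => /eqP/hnorm_eq0 ->.
by rewrite ip_self !ripE -hnorm_sqr expr2 mulKf// mulVf.
Qed.

(** The component [z] of the new vector orthogonal to the list built so far is normalised and added,
    unless it vanishes. Applied to a concatenation, this gives one orthonormal list spanning two
    given ones. *)
Lemma Gram_Schmidt (l : seq V) :
  exists2 s, ortho_seq s & forall v, v \in l -> oproj s v = v.
Proof.
elim: l => [|v l [s os hs]]; first by exists [::].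
pose z := v - oproj s v.
have [z0|z0] := eqVneq z 0.
  exists s => // w; rewrite inE => /orP[/eqP->|/hs//].
  by apply/esym/eqP; rewrite -subr_eq0; apply/eqP.
have hz : hn z != 0 by apply: contra z0 => /eqP/hnorm_eq0 ->.
pose e := (hn z)^-1 *:r z.
have ea a : a \in s -> ip e a = 0.
  by move=> sa; rewrite ipZl ipBl ip_oproj// subrr mulr0.
have pe w : ip (oproj s w) e = 0.
  rewrite ip_suml big_seq big1// => a sa.
  by rewrite ipZl (ipC a) ea// conjc0 mulr0.
exists (e :: s); first by apply: ortho_seq_cons => //; exact: unit_vector.
move=> w; rewrite inE /oproj big_cons -/(oproj s w) => /orP[/eqP->|lw].
  have -> : ip v e = (hn z)%:C%C.
    rewrite -[v](subrK (oproj s v)) ipDl pe addr0 -/z ipZr ip_self conjc_real.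
    by rewrite -rmorphM -hnorm_sqr expr2 mulKf.
  by rewrite scalerA -rmorphM mulfV// scale1r subrK.
by rewrite -{1}(hs w lw) pe scale0r add0r hs.
Qed.

(** * Traces of positive operators *)

Definition ontr (T : V -> V) (s : seq V) : R := \sum_(a <- s) rip a (T a).

(* The difference of the two sides is [ontr T] of the components of [g]
   orthogonal to [f]. *)
Lemma ontr_le T f g : positive_op ip T -> ortho_seq f ->
  (forall a, a \in f -> oproj g a = a) -> ontr T f <= ontr T g.
Proof.
move=> pT of_ fg; have [bT sT rT] := (positive_op_ripP T).1 pT.
have fg' a : a \in f -> a = \sum_(b <- g) ip a b *: b by move/fg => {1}<-.
have : 0 <= \sum_(b <- g) rip (b - oproj f b) (T (b - oproj f b)).
  by apply: sumr_ge0.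
(* Expanding the vectors of [f] along [g] and exchanging sums, the mixed and the quadratic terms
   both become [ontr T f]; the nonnegative sum is thus [ontr T g - 2 ontr T f + ontr T f]. *)
have E1 : \sum_(b <- g) rip b (T (oproj f b)) = ontr T f.
  rewrite -Re_sum /ontr -Re_sum; congr complex.Re.
  under eq_bigr do rewrite (op_sum bT) ip_sumr.
  rewrite exchange_big /= big_seq [RHS]big_seq; apply: eq_bigr => a fa.
  rewrite [X in _ = ip X _](fg' a fa) ip_suml; apply: eq_bigr => b _.
  by rewrite (opZ bT) ipZr ipZl -ipC.
have E2 : \sum_(b <- g) rip (oproj f b) (T (oproj f b)) = ontr T f.
  rewrite -Re_sum /ontr -Re_sum; congr complex.Re.
  under eq_bigr do rewrite ip_suml.
  rewrite exchange_big /= big_seq [RHS]big_seq; apply: eq_bigr => a fa.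
  rewrite -[X in _ = ip _ (T X)](oproj_id of_ fa).
  rewrite [X in _ = ip _ (T (oproj f X))](fg' a fa) oproj_sum (op_sum bT) ip_sumr.
  apply: eq_bigr => b _.
  by rewrite oprojZ (opZ bT) ipZl ipZr -ipC.
under eq_bigr => b _.
  rewrite (opB bT) !ripE -(sT (oproj f b) b) (ripC _ b); over.
rewrite !(big_split, sumrN) /=.
rewrite E1 E2 -/(ontr T g); lra.
Qed.

Lemma ontr_le_optrace T s : ortho_seq s -> ((ontr T s)%:E <= optrace ip T)%E.
Proof.
move=> [us os]; apply: ereal_sup_ubound.
exists (size s), (fun i => nth 0 s i); split.
  by move=> i j; rewrite os ?mem_nth// nth_uniq.
by rewrite /ontr (big_nth 0) big_mkord.
Qed.

Lemma optrace_le T M : (forall s, ortho_seq s -> ((ontr T s)%:E <= M)%E) ->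
  (optrace ip T <= M)%E.
Proof.
move=> h; apply: ge_ereal_sup => _ [n [e [oe ->]]].
(* An orthonormal family is injective, so its list of values has no repetition. *)
have injE i j : (e i == e j) = (i == j).
  apply/eqP/eqP => [eij|->//]; apply/eqP; have := oe i j.
  rewrite -eij oe eqxx; case: eqP => // _ /eqP.
  by rewrite oner_eq0.
have -> : \sum_(i < n) rip (e i) (T (e i)) = ontr T [seq e i | i <- enum 'I_n].
  by rewrite /ontr big_map big_enum.
apply: h; split.
  by rewrite map_inj_uniq ?enum_uniq// => i j /eqP; rewrite injE => /eqP.
by move=> _ _ /mapP[i _ ->] /mapP[j _ ->]; rewrite oe injE.
Qed.

Lemma optrace_ge0 T : (0 <= optrace ip T)%E.
Proof.
have : ortho_seq [::] by [].
by move/(ontr_le_optrace T); rewrite /ontr big_nil.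
Qed.

Local Notation tr T := (fine (optrace ip T)).

Lemma tr_ge0 T : 0 <= tr T.
Proof. exact/fine_ge0/optrace_ge0. Qed.

Lemma ontr_le_tr T s : (optrace ip T < +oo)%E -> ortho_seq s -> ontr T s <= tr T.
Proof.
move=> fT os; rewrite -lee_fin fineK ?ontr_le_optrace//.
by rewrite ge0_fin_numE// optrace_ge0.
Qed.

Lemma optrace_le_fin T M : (forall s, ortho_seq s -> ontr T s <= M) ->
  (optrace ip T < +oo)%E /\ tr T <= M.
Proof.
move=> h; have hM : (optrace ip T <= M%:E)%E.
  by apply: optrace_le => s os; rewrite lee_fin h.
have fT := le_lt_trans hM (ltry M); split=> //.
by rewrite -lee_fin fineK// ge0_fin_numE// optrace_ge0.
Qed.

(** The normalised vector [x] alone is an orthonormal list competing in the supremum. *)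
Lemma form_le_tr T x : (optrace ip T < +oo)%E -> positive_op ip T ->
  rip x (T x) <= tr T * rip x x.
Proof.
move=> fT pT; have [bT _ _] := (positive_op_ripP T).1 pT.
have [->|x0] := eqVneq x 0; first by rewrite !ip0l mulr0.
have hx : hn x != 0 by apply: contra x0 => /eqP/hnorm_eq0 ->.
have os : ortho_seq [:: (hn x)^-1 *:r x].
  by apply: ortho_seq_cons => //; exact: unit_vector.
have := ontr_le_tr fT os; rewrite /ontr big_seq1 (opZ bT) !ripE -hnorm_sqr.
rewrite mulrA -invfM -expr2 mulrC ler_pdivrMr// exprn_gt0//.
by rewrite lt_neqAle eq_sym hx hnorm_ge0.
Qed.

(** The form bound with [c = tr T] is used twice: [||T x||^2 <= c <x, T x> <= c^2 ||x||^2]. *)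
Lemma hnorm_le_tr T x : (optrace ip T < +oo)%E -> positive_op ip T ->
  hn (T x) <= tr T * hn x.
Proof.
move=> fT pT; have t0 := tr_ge0 T.
rewrite hnorm_le ?mulr_ge0 ?hnorm_ge0// exprMn hnorm_sqr.
have hf y := form_le_tr y fT pT.
apply: le_trans (positive_form_bound pT hf x) _.
by rewrite expr2 -mulrA ler_wpM2l.
Qed.

(** Lists chosen separately for [A] and for [B] lie in the span of one orthonormal list, on which
    both partial traces are at least as large. Taking suprema one after the other gives the
    inequality; an empty list on one side gives finiteness. *)
Lemma tr_superadditive T A B : positive_op ip A -> positive_op ip B ->
  (forall x, T x = A x + B x) -> (optrace ip T < +oo)%E ->
  [/\ (optrace ip A < +oo)%E, (optrace ip B < +oo)%E & tr A + tr B <= tr T].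
Proof.
move=> pA pB TAB fT.
have TE s : ontr T s = ontr A s + ontr B s.
  by rewrite /ontr -big_split; apply: eq_bigr => a _; rewrite TAB ripDr.
have key s t : ortho_seq s -> ortho_seq t -> ontr A s + ontr B t <= tr T.
  move=> os ot; have [g og hg] := Gram_Schmidt (s ++ t).
  apply: le_trans (ontr_le_tr fT og); rewrite TE; apply: lerD; apply: ontr_le => // a ha;
    by apply: hg; rewrite mem_cat ha ?orbT.
have o0 : ortho_seq [::] by [].
have n0 X : ontr X [::] = 0 by rewrite /ontr big_nil.
have [fA _] : (optrace ip A < +oo)%E /\ tr A <= tr T.
  by apply: optrace_le_fin => s os; have := key _ _ os o0; rewrite n0 addr0.
have [fB _] : (optrace ip B < +oo)%E /\ tr B <= tr T.
  by apply: optrace_le_fin => s os; have := key _ _ o0 os; rewrite n0 add0r.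
split=> //; rewrite -lerBrDr; apply: (optrace_le_fin _).2 => s os.
rewrite lerBrDr addrC -lerBrDr; apply: (optrace_le_fin _).2 => t ot.
by rewrite lerBrDr addrC; exact: key.
Qed.

(** * Closures of subspaces, spans and ranges *)

Lemma hclosure_linear (S : set V) :
  (forall c x y, S x -> S y -> S (c *: x + y)) ->
  forall c x y, hclosure ip S x -> hclosure ip S y -> hclosure ip S (c *: x + y).
Proof.
move=> lS c x y hx hy e e0.
have c1 : 0 < cabs c + 1.
  by rewrite ltr_wpDl// /cabs; case: (c) => ? ?; exact: sqrtr_ge0.
have [x' Sx' hx'] := hx _ (divr_gt0 (divr_gt0 e0 (ltr0Sn _ 1)) c1).
have [y' Sy' hy'] := hy _ (divr_gt0 e0 (ltr0Sn _ 1)).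
exists (c *: x' + y'); first exact: lS.
rewrite opprD addrACA -scalerBr.
have := hnormD (c *: (x - x')) (y - y'); rewrite hnormZc.
move: hx'; rewrite ltr_pdivlMr//; have := hnorm_ge0 (x - x'); lra.
Qed.

Lemma linear_closed_sum (S : set V) (I : Type) (s : seq I) (p : pred I)
    (c : I -> C) (F : I -> V) :
  (forall c x y, S x -> S y -> S (c *: x + y)) -> S 0 -> (forall i, p i -> S (F i)) ->
  S (\sum_(i <- s | p i) c i *: F i).
Proof.
move=> lS S0 SF; elim: s => [|i s IH]; first by rewrite big_nil.
by rewrite big_cons; case: ifPn => // pi; apply: lS => //; exact: SF.
Qed.

Lemma lin_span_linear (S : set V) c x y :
  lin_span S x -> lin_span S y -> lin_span S (c *: x + y).
Proof.
move=> [n1 [c1 [v1 [h1 ->]]]] [n2 [c2 [v2 [h2 ->]]]].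
exists (n1 + n2)%N,
  (fun i => match fintype.split i with inl j => c * c1 j | inr j => c2 j end),
  (fun i => match fintype.split i with inl j => v1 j | inr j => v2 j end); split.
  by move=> i; case: fintype.split.
rewrite big_split_ord /= scaler_sumr; congr (_ + _); apply: eq_bigr => i _.
  by rewrite (unsplitK (inl i)) scalerA.
by rewrite (unsplitK (inr i)).
Qed.

Lemma lin_span0 (S : set V) : lin_span S 0.
Proof. by exists 0%N, (fun=> 0), (fun=> 0); split=> [[]//|]; rewrite big_ord0. Qed.

Lemma lin_span_incl (S : set V) : S `<=` lin_span S.
Proof.
move=> x Sx; exists 1%N, (fun=> 1), (fun=> x); split=> //.
by rewrite big_ord1 scale1r.
Qed.

Lemma range_linear T : bounded_op ip T ->
  forall c x y, range T x -> range T y -> range T (c *: x + y).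
Proof.
move=> bT c _ _ [x _ <-] [y _ <-]; exists (c *: x + y) => //.
by rewrite (opD bT) (opZ bT).
Qed.

Lemma orth_proj_range_closed T : orth_proj ip T ->
  hclosure ip (range T) `<=` range T.
Proof.
move=> [bT TT _] x hx; exists x => //; apply/eqP; rewrite -subr_eq0; apply/eqP/hnorm_eq0.
apply/eqP; rewrite eq_le hnorm_ge0 andbT; apply/ler_addgt0Pl => e e0; rewrite addr0.
have [c c0 hc] := op_bound bT; have c1 : 0 < c + 1 by lra.
have [_ [y _ <-]] := hx _ (divr_gt0 e0 c1); rewrite ltr_pdivlMr// => h.
have := hnorm_dist (T x) (T y) x; rewrite -{1}(TT y) -(opB bT) (hnormB (T y)).
by have := hc (x - T y); lra.
Qed.

(** The range of [S] lies in the closure of that of [S^2 = T], which is closed; conversely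
    [T x = S (S x)]. *)
Lemma range_closure_orth_proj T S : orth_proj ip T -> positive_op ip S ->
  (forall x, S (S x) = T x) -> hclosure ip (range S) = range T.
Proof.
move=> oT pS SS; apply/seteqP; split.
  apply: subset_trans (orth_proj_range_closed oT).
  apply: hclosure_sub => _ [x _ <-].
  have := range_sub_closure_range_sqr pS x.
  by rewrite (_ : S \o S = T)//; apply/funext.
by move=> _ [x _ <-]; apply: hclosure_incl; rewrite -SS; exists (S x).
Qed.

(** * The energy tree and its traces *)

Section EnergyTree.
Context (m : nat) (P : 'I_m -> V -> V) (R0 : V -> V).
Context (oP : forall j, orth_proj ip (P j)) (pR0 : positive_op ip R0).

Local Notation Rw := (Rw ip P R0).
Local Notation Dw := (Dw ip P R0).
Local Notation S w := (opsqrt ip (Rw w)).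
Local Notation H0 := (hclosure ip (range (opsqrt ip R0))).

Lemma Rw_rcons w j x : Rw (rcons w j) x = S w (S w x - P j (S w x)).
Proof. by rewrite /Defs.Rw foldl_rcons. Qed.

Lemma orth_proj_sym j x y : rip (P j x) y = rip x (P j y).
Proof. by case: (oP j) => _ _ ->. Qed.

Lemma orth_proj_rip j x : rip x (P j x) = rip (P j x) (P j x).
Proof. by rewrite orth_proj_sym; case: (oP j) => _ -> _. Qed.

Lemma positive_conj A B : positive_op ip A -> positive_op ip B ->
  positive_op ip (fun x => A (B (A x))).
Proof.
move=> /positive_op_ripP[bA sA _] /positive_op_ripP[bB sB rB].
apply/positive_op_ripP; split.
- exact: bounded_op_comp bA (bounded_op_comp bB bA).
- by move=> x y; rewrite sA sB sA.
- by move=> x; rewrite -sA.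
Qed.

Lemma orth_proj_positive j : positive_op ip (P j).
Proof.
apply/positive_op_ripP; split; first by case: (oP j).
- exact: orth_proj_sym.
- by move=> x; rewrite orth_proj_rip rip_ge0.
Qed.

Lemma orth_compl_positive j : positive_op ip (fun x => x - P j x).
Proof.
have [bP PP _] := oP j.
apply/positive_op_ripP; split; first exact: bounded_op_sub bounded_op_id bP.
- by move=> x y; rewrite !ripE orth_proj_sym.
- move=> x; have := rip_ge0 (x - P j x).
  by rewrite !ripE (ripC (P j x) x) -orth_proj_rip; lra.
Qed.

Lemma Rw_positive w : positive_op ip (Rw w).
Proof.
elim/last_ind: w => [//|w j IH].
have [pS _] := opsqrtP IH.
rewrite (_ : Rw (rcons w j) = fun x => S w (S w x - P j (S w x))).
  exact: (positive_conj pS (orth_compl_positive j)).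
by apply/funext => x; rewrite Rw_rcons.
Qed.

Lemma sqrtRw_positive w : positive_op ip (S w).
Proof. exact: (opsqrtP (Rw_positive w)).1. Qed.

Lemma sqrtRwK w x : S w (S w x) = Rw w x.
Proof. exact: (opsqrtP (Rw_positive w)).2. Qed.

Lemma Dw_positive w j : positive_op ip (Dw w j).
Proof. exact: (positive_conj (sqrtRw_positive w) (orth_proj_positive j)). Qed.

(** Energy balance at a node, the source of both the trace inequality for a child and the
    telescoping along a path. *)
Lemma Rw_split w j x : Rw w x = Rw (rcons w j) x + Dw w j x.
Proof.
have [bS _] := sqrtRw_positive w.
by rewrite Rw_rcons /Dw (opB bS) sqrtRwK subrK.
Qed.

(** The range of a root lies in the closure of the range of its square, and [R_wj] starts on the
    left with the root of [R_w]; induction descends to the empty word. *)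
Lemma sqrtRw_range w x : H0 (S w x).
Proof.
elim/last_ind: w x => [|w j IH] x; first by apply: hclosure_incl; exists x.
have := range_sub_closure_range_sqr (sqrtRw_positive (rcons w j)) x.
apply: hclosure_sub => _ [y _ <-] /=.
by rewrite sqrtRwK Rw_rcons.
Qed.

Context (fR0 : (optrace ip R0 < +oo)%E).

Lemma Rw_trace w : (optrace ip (Rw w) < +oo)%E.
Proof.
elim/last_ind: w => [//|w j IH].
by case: (tr_superadditive (Rw_positive (rcons w j)) (Dw_positive w j) (Rw_split w j) IH).
Qed.

Lemma tr_Rw_rcons w j : tr (Rw (rcons w j)) + s_tr ip P R0 w j <= tr (Rw w).
Proof.
by case: (tr_superadditive (Rw_positive (rcons w j)) (Dw_positive w j) (Rw_split w j)
  (Rw_trace w)).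
Qed.

Lemma Dw_trace w j : (optrace ip (Dw w j) < +oo)%E.
Proof.
by case: (tr_superadditive (Rw_positive (rcons w j)) (Dw_positive w j) (Rw_split w j)
  (Rw_trace w)).
Qed.

(** For each [a] in an orthonormal list, leakage is applied to the vector [R_w^(1/2) a] of [H_0].
    Summing over [a] and exchanging with the sum over [j] yields partial traces of the [D_wj]. *)
Lemma leakage_trace (alpha : R) : 0 < alpha ->
  (forall v, H0 v -> alpha * hn v ^+ 2 <= rip v (\sum_(j < m) P j v)) ->
  forall w, alpha * tr (Rw w) <= S_tr ip P R0 w.
Proof.
move=> a0 hl w; rewrite mulrC -ler_pdivlMr//.
apply: (optrace_le_fin _).2 => s os; rewrite ler_pdivlMr// mulrC.
have [bS sS _] := (positive_op_ripP _).1 (sqrtRw_positive w).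
apply: (@le_trans _ _ (\sum_(j < m) ontr (Dw w j) s)); last first.
  by apply: ler_sum => j _; apply: ontr_le_tr => //; exact: Dw_trace.
rewrite /ontr exchange_big mulr_sumr /=; apply: ler_sum => a _.
rewrite -sqrtRwK -sS -hnorm_sqr; apply: le_trans (hl _ (sqrtRw_range w a)) _.
rewrite ip_sumr Re_sum; apply: ler_sum => j _.
by rewrite /Dw -sS.
Qed.

Lemma p_tr_decay (alpha : R) (q : 'I_m -> R) : (0 < m)%N -> 0 < alpha ->
  (forall v, H0 v -> alpha * hn v ^+ 2 <= rip v (\sum_(j < m) P j v)) ->
  (forall j, 0 <= q j) ->
  forall w, \sum_j p_tr ip P R0 q w j * tr (Rw (rcons w j))
    <= (1 - alpha / m%:R) * tr (Rw w).
Proof.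
move=> m_gt0 a0 hl q0 w; have mp : 0 < m%:R :> R by rewrite ltr0n.
have hS := leakage_trace a0 hl w.
have t0 := tr_ge0 (Rw w).
have s0 j : 0 <= s_tr ip P R0 w j by exact: tr_ge0.
(* In the fallback case leakage forces [tr R_w = 0], hence the traces at the children vanish as
   well, whatever the weights [q]. *)
rewrite /p_tr; case: (ltrP 0 (S_tr ip P R0 w)) => [Sp|Sn]; last first.
  have tw0 : tr (Rw w) = 0.
    by apply/eqP; rewrite eq_le t0 andbT -(pmulr_rle0 _ a0) (le_trans hS).
  rewrite tw0 mulr0; apply: sumr_le0 => j _; rewrite mulr_ge0_le0//.
  by have := tr_Rw_rcons w j; have := s0 j; lra.
set S := S_tr _ _ _ _ in hS Sp *.
apply: (@le_trans _ _ (\sum_j s_tr ip P R0 w j / S * (tr (Rw w) - s_tr ip P R0 w j))).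
  apply: ler_sum => j _; apply: ler_wpM2l; first by rewrite divr_ge0// ltW.
  by have := tr_Rw_rcons w j; lra.
rewrite (eq_bigr (fun j => s_tr ip P R0 w j * (tr (Rw w) / S)
    - s_tr ip P R0 w j ^+ 2 * S^-1)) => [|j _]; last by ring.
rewrite big_split /= sumrN -!mulr_suml -/(S_tr ip P R0 w) -/S.
(* Size biasing pays off here: the expected drop is [Q / S] with [Q] the sum of squares, and
   [Q >= S^2 / m]. *)
have := sqr_sum_le (s_tr ip P R0 w) m_gt0; rewrite -/(S_tr ip P R0 w) -/S.
set Q := \sum_j _ => hQ.
have -> : S * (tr (Rw w) / S) = tr (Rw w) by field; rewrite gt_eqF.
have : S / m%:R <= Q / S.
  by rewrite ler_pdivrMr// mulrAC ler_pdivlMr// -expr2 mulrC.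
have : alpha / m%:R * tr (Rw w) <= S / m%:R.
  by rewrite mulrAC ler_pM2r// invr_gt0.
lra.
Qed.

(** * Expansion along one path whose residual traces become arbitrarily small *)

Section FrameAlongPath.
Context (om : nat -> 'I_m).
Context (small : forall e : R, 0 < e -> exists k, tr (Rw (mkseq om k)) < e).
Context (Rset : nat -> set nat) (u : nat -> nat -> V) (lam : nat -> nat -> R).
Context (ou : forall k, (1 <= k)%N -> orthonormal_on ip (Rset k) (u k)).
Context (lam0 : forall k, (1 <= k)%N -> forall r, Rset k r -> 0 <= lam k r).

Local Notation Delta := (Delta ip P R0 om).

Context (specD : forall k, (1 <= k)%N -> forall x, vcvg ip
  (fun N => \sum_(0 <= r < N | r \in Rset k)
     (lam k r)%:C%C *: (ip x (u k r) *: u k r)) (Delta k x)).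

Local Notation phi k r := ((Num.sqrt (lam k r))%:C%C *: u k r).
Local Notation idx := [set kr : nat * nat | (1 <= kr.1)%N /\ Rset kr.1 kr.2].
Local Notation Phi := [set phi kr.1 kr.2 | kr in idx].

Lemma Delta_positive k : positive_op ip (Delta k).
Proof. exact: Dw_positive. Qed.

(** The energy balance telescopes. Since [Delta k] is built on the prefix of length [k - 1], the
    first [N] increments end at the prefix of length [N]. *)
Lemma sum_Delta N x :
  \sum_(1 <= k < N.+1) Delta k x = R0 x - Rw (mkseq om N) x.
Proof.
elim: N => [|N IH]; first by rewrite big_nil subrr.
rewrite mkseqS big_nat_recr //= IH (Rw_split (mkseq om N) (om N)).
by rewrite opprD addrA subrK.
Qed.

Lemma tr_Rw_path_le k l : (k <= l)%N -> tr (Rw (mkseq om l)) <= tr (Rw (mkseq om k)).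
Proof.
move=> /subnK <-; elim: (l - k)%N => [//|i IH]; rewrite addSn mkseqS.
move: (i + k)%N IH => {}i IH; have := tr_Rw_rcons (mkseq om i) (om i).
have : 0 <= s_tr ip P R0 (mkseq om i) (om i) by exact: tr_ge0.
lra.
Qed.

(** Monotonicity along the path upgrades one small index to all later ones; [b] will be [||x||] or
    [||x||^2]. *)
Lemma tr_Rw_path_small e b : 0 < e -> 0 <= b ->
  exists N, forall k, (N <= k)%N -> tr (Rw (mkseq om k)) * b < e.
Proof.
move=> e0 b0; have b1 : 0 < b + 1 by lra.
have [N] := small (divr_gt0 e0 b1); rewrite ltr_pdivlMr// => hN; exists N => k Nk.
have := tr_Rw_path_le Nk; have := tr_ge0 (Rw (mkseq om k)); nra.
Qed.

Lemma sum_Delta_cvg x : vcvg ip (fun N => \sum_(1 <= k < N.+1) Delta k x) (R0 x).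
Proof.
move=> e e0; have [N hN] := tr_Rw_path_small e0 (hnorm_ge0 x).
exists N => k /hN; rewrite sum_Delta addrC addKr hnormN; apply: le_lt_trans.
by apply: hnorm_le_tr; [exact: Rw_trace|exact: Rw_positive].
Qed.

Lemma cabs_real (a : R) : cabs a%:C%C = `|a|.
Proof. by rewrite /cabs /= expr0n addr0 sqrtr_sqr. Qed.

Lemma sum_ip_Delta_cvg x :
  ccvg (fun N => \sum_(1 <= k < N.+1) ip x (Delta k x)) (ip x (R0 x)).
Proof.
move=> e e0; have [N hN] := tr_Rw_path_small e0 (rip_ge0 x).
exists N => k /hN; rewrite -ip_sumr sum_Delta ipBr addrC addKr.
rewrite (positive_ip (Rw_positive _)) -rmorphN cabs_real normrN; apply: le_lt_trans.
rewrite ger0_norm; first by apply: form_le_tr; [exact: Rw_trace|exact: Rw_positive].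
by have [_ _] := (positive_op_ripP _).1 (Rw_positive (mkseq om k)).
Qed.

Lemma sum_ip_Delta_nd x N : \sum_(1 <= k < N.+1) ip x (Delta k x)
  <= \sum_(1 <= k < N.+2) ip x (Delta k x).
Proof.
rewrite [leRHS]big_nat_recr //= lerDl.
by have [_] := Delta_positive N.+1.
Qed.

(** Pairing the spectral partial sum with [x] turns each term into [lam |<x, u>|^2], so strong
    convergence at a level gives the scalar identity there. *)
Lemma frame_partial k x N : (1 <= k)%N ->
  \sum_(0 <= r < N | r \in Rset k) cabs (ip x (phi k r)) ^+ 2 =
  rip (\sum_(0 <= r < N | r \in Rset k) (lam k r)%:C%C *: (ip x (u k r) *: u k r)) x.
Proof.
move=> k1; rewrite ip_suml Re_sum; apply: eq_bigr => r; rewrite in_setE => rk.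
rewrite ipZr conjc_real ipZl ReZ ipZl (ipC (u k r) x).
move: (sqr_sqrtr (lam0 k1 rk)); move: (Num.sqrt _) => s <-.
case: (ip x _) => a b; rewrite /cabs /= sqr_sqrtr ?addr_ge0 ?sqr_ge0//; ring.
Qed.

Lemma frame_level_cvg k x : (1 <= k)%N -> forall e, 0 < e -> exists N, forall l,
  (N <= l)%N -> `|\sum_(0 <= r < l | r \in Rset k) cabs (ip x (phi k r)) ^+ 2 -
    rip x (Delta k x)| < e.
Proof.
move=> k1 e e0; have [N hN] := vcvg_rip x (specD k1 x) e0.
by exists N => l /hN; rewrite frame_partial// (ripC x).
Qed.

Lemma frame_level_ccvg k x : (1 <= k)%N ->
  ccvg (fun N => \sum_(0 <= r < N | r \in Rset k) ((cabs (ip x (phi k r))) ^+ 2)%:C%C)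
    (ip x (Delta k x)).
Proof.
move=> k1 e /(frame_level_cvg x k1)[N hN]; exists N => l /hN.
by rewrite (positive_ip (Delta_positive k)) -rmorph_sum -rmorphB cabs_real.
Qed.

(** Nonnegativity allows summation first over [r], giving [<x, Delta_k x>], and then over [k],
    giving [<x, R_0 x>]. *)
Lemma frame_esum x :
  (\esum_(kr in idx) ((cabs (ip x (phi kr.1 kr.2))) ^+ 2)%:E = (rip x (R0 x))%:E)%E.
Proof.
rewrite (_ : idx = [set k | (1 <= k)%N] `*`` Rset)//.
rewrite -(@esum_esum _ _ _ _ _ (fun k r => (cabs (ip x (phi k r)) ^+ 2)%:E)) => [|k r];
  last by rewrite lee_fin sqr_ge0.
under eq_esum => k /= k1.
  rewrite (esum_fin_lim _ (frame_level_cvg x k1)); last by move=> r _; exact: sqr_ge0.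
  over.
apply: esum_fin_lim => [k _|e e0].
  by have [_ _] := (positive_op_ripP _).1 (Delta_positive k).
(* Partial sums of [esum_fin_lim] start at 0, where the index set contributes nothing; the bound
   [k.+1] corresponds to the first [k] increments. *)
have [N hN] := sum_ip_Delta_cvg x e0; exists N.+1 => -[//|k] /hN.
have -> : \sum_(0 <= r < k.+1 | r \in [set k | (1 <= k)%N]) rip x (Delta r x) =
    complex.Re (\sum_(1 <= r < k.+1) ip x (Delta r x)).
  rewrite Re_sum big_mkcond big_ltn//=.
  case: ifPn => [|_]; first by rewrite inE.
  rewrite add0r big_nat [RHS]big_nat; apply: eq_bigr => r /andP[r1 _].
  by case: ifPn => //; rewrite notin_setE.
apply: le_lt_trans; rewrite -ReN -ReD /cabs; case: (_ - _) => a b /=.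
by rewrite -sqrtr_sqr ler_wsqrtr// lerDl sqr_ge0.
Qed.

(** At [x = u k r] orthonormality leaves a single term, so the partial sums are constant from [r.+1]
    on. *)
Lemma Delta_eigen k r : (1 <= k)%N -> Rset k r ->
  Delta k (u k r) = (lam k r)%:C%C *: u k r.
Proof.
move=> k1 kr; apply: vcvg_unique (specD k1 _) _ => e e0; exists r.+1 => l rl.
rewrite big_mkcond (bigD1_seq r) /= ?iota_uniq ?mem_index_iota// mem_set//.
rewrite (ou k1 kr kr) eqxx scale1r big1 ?addr0 ?subrr ?hnorm0// => s sr.
case: ifPn => //; rewrite in_setE => ks.
by rewrite (ou k1 kr ks) eq_sym (negbTE sr) scale0r scaler0.
Qed.

(** A zero eigenvalue gives the zero vector. Otherwise [u = lam^-1 Delta u] lies in the range of the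
    root at the prefix, hence in [H_0]. *)
Lemma frame_in_range : Phi `<=` H0.
Proof.
move=> _ [[k r] [/= k1 kr] <-].
have [l0|l0] := eqVneq (lam k r) 0.
  rewrite l0 sqrtr0 scale0r; apply: hclosure_incl; exists 0 => //.
  by have [[bS _] _] := opsqrtP pR0; exact: op0 bS.
have [bS _] := sqrtRw_positive (mkseq om k.-1).
have -> : u k r = (lam k r)^-1%:C%C *: Delta k (u k r).
  by rewrite Delta_eigen// scalerA -rmorphM mulVf// scale1r.
rewrite scalerA /Defs.Delta /Defs.Dw -(opZ bS); exact: sqrtRw_range.
Qed.

Lemma Delta_in_span k x : (1 <= k)%N -> hclosure ip (lin_span Phi) (Delta k x).
Proof.
move=> k1; apply: hclosure_vcvg (specD k1 x) => N.
(* Writing [lam] as the square of its root exhibits the partial sum as a combination of frame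
   vectors. *)
rewrite (eq_bigr (fun r => ((Num.sqrt (lam k r))%:C%C * ip x (u k r)) *: phi k r)).
  apply: linear_closed_sum; [exact: lin_span_linear|exact: lin_span0|].
  by move=> r; rewrite in_setE => kr; apply: lin_span_incl; exists (k, r).
move=> r; rewrite in_setE => kr; rewrite !scalerA mulrAC -rmorphM -expr2.
by rewrite sqr_sqrtr// lam0.
Qed.

(** For the harder inclusion, the range of [R_0^(1/2)] lies in the closure of that of [R_0], and
    [R_0 y] is the limit of sums of vectors [Delta_k y] from the closed span. *)
Lemma frame_closed_span : hclosure ip (lin_span Phi) = H0.
Proof.
have [pS SS] := opsqrtP pR0; have [bS _] := pS.
apply/seteqP; split; apply: hclosure_sub.
  move=> _ [N [c [v [hv ->]]]]; apply: linear_closed_sum.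
  - exact: hclosure_linear (range_linear bS).
  - by apply: hclosure_incl; exists 0 => //; exact: op0.
  - by move=> i _; exact: frame_in_range.
move=> _ [x _ <-].
have := range_sub_closure_range_sqr pS x.
apply: hclosure_sub => _ [y _ <-] /=; rewrite SS.
have := @hclosure_vcvg (hclosure ip (lin_span Phi)) _ _ _ (sum_Delta_cvg y).
move=> /(_ _)/hclosure_sub; apply => // N.
rewrite big_nat (eq_bigr (fun k => 1 *: Delta k y)) => [|k _]; last by rewrite scale1r.
apply: linear_closed_sum; first by apply: hclosure_linear; exact: lin_span_linear.
  by apply: hclosure_incl; exact: lin_span0.
by move=> k /andP[k1 _]; exact: Delta_in_span.
Qed.

End FrameAlongPath.
End EnergyTree.
End Complete.
End InnerProduct.

(** * Almost sure vanishing of a function on words that decays in mean *)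

Section PathMeasure.
Context {R : realType} {n : nat}.
Context (nu : probability (g_sigma_algebraType (@cylinders n)) R).
Context (c tau : seq 'I_n.+2 -> R) (p : seq 'I_n.+2 -> 'I_n.+2 -> R) (delta : R).
Context (nuE : forall w, nu (cyl w) = (c w)%:E).
Context (c_rcons : forall w j, c (rcons w j) = c w * p w j).
Context (tau0 : forall w, 0 <= tau w) (delta0 : 0 < delta).
Context (decay : forall w, \sum_j p w j * tau (rcons w j) <= (1 - delta) * tau w).

Fixpoint words (k : nat) : seq (seq 'I_n.+2) :=
  if k is k'.+1 then [seq rcons w j | w <- words k', j <- enum 'I_n.+2] else [:: [::]].

Lemma mkseq_words om k : mkseq om k \in words k.
Proof.
elim: k => [//|k IH]; rewrite mkseqS.
by apply/allpairsP; exists (mkseq om k, om k); split; rewrite ?mem_enum.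
Qed.

Lemma size_words k w : w \in words k -> size w = k.
Proof.
elim: k w => [|k IH] w; first by rewrite inE => /eqP ->.
by case/allpairsP => -[v j] /= [/IH hv _ ->]; rewrite size_rcons hv.
Qed.

Lemma cyl_measurable w : measurable (cyl w : set (g_sigma_algebraType (@cylinders n))).
Proof. by apply: sub_sigma_algebra; exists w. Qed.

Lemma c_ge0 w : 0 <= c w.
Proof. by rewrite -lee_fin -nuE. Qed.

(** The expectation of [tau] at the prefix of length [k], since the cylinders of that length
    partition the path space. *)
Definition mean (k : nat) : R := \sum_(w <- words k) c w * tau w.

Lemma mean_ge0 k : 0 <= mean k.
Proof. by apply: sumr_ge0 => w _; rewrite mulr_ge0// c_ge0. Qed.

Lemma mean_decay k : mean k.+1 <= mean k - delta * mean k.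
Proof.
rewrite /mean /= big_allpairs_dep /= -[X in X - _]mul1r -mulrBl mulr_sumr.
apply: ler_sum => w _; rewrite big_enum /= mulrCA.
apply: le_trans (ler_wpM2l (c_ge0 w) (decay w)).
by rewrite mulr_sumr; apply: ler_sum => j _; rewrite c_rcons mulrA.
Qed.

(** If every mean were at least [e], each step would lose at least [delta * e]. *)
Lemma mean_small e : 0 < e -> exists k, mean k < e.
Proof.
move=> e0; apply: contrapT => /forallNP h.
apply: (@no_infinite_descent R mean (delta * e)).
- exact: mulr_gt0.
- exact: mean_ge0.
move=> k; apply: le_trans (mean_decay k) _; rewrite lerB// ler_pM2l//.
by rewrite leNgt; apply/negP/h.
Qed.

Definition large_at (e : R) k : set (g_sigma_algebraType (@cylinders n)) :=
  [set om | e <= tau (mkseq om k)].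

(** The event depends on the first [k] letters only, so it is a finite union of cylinders of known
    mass. *)
Lemma large_atE e k :
  large_at e k = \big[setU/set0]_(w <- words k | e <= tau w) cyl w.
Proof.
rewrite -bigcup_seq_cond; apply/seteqP; split=> [om /= h|om /= [w /= /andP[wk ew]]].
  by exists (mkseq om k) => /=; rewrite ?mkseq_words// /cyl /= size_mkseq.
by rewrite /cyl /large_at /= (size_words wk) => ->.
Qed.

Lemma large_at_measurable e k : measurable (large_at e k).
Proof.
by rewrite large_atE; apply: bigsetU_measurable => w _; exact: cyl_measurable.
Qed.

(** Markov's inequality, by subadditivity over the cylinders: each one counted has
    [tau w / e >= 1]. *)
Lemma large_at_le e k : 0 < e -> (nu (large_at e k) <= (mean k / e)%:E)%E.
Proof.
move=> e0; rewrite large_atE /mean mulr_suml.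
elim: (words k) => [|w s IH]; first by rewrite !big_nil measure0.
rewrite !big_cons EFinD.
have t0 : 0 <= c w * tau w / e by rewrite divr_ge0 ?mulr_ge0 ?c_ge0// ltW.
case: ifPn => ew; last by apply: le_trans IH _; rewrite leeDr// lee_fin.
apply: le_trans (measureU2 _ _ _) _; first exact: cyl_measurable.
  by apply: bigsetU_measurable => v _; exact: cyl_measurable.
apply: leeD => //; apply: (@le_trans _ _ (c w)%:E); first by rewrite -nuE.
rewrite lee_fin ler_pdivlMr//.
by rewrite ler_wpM2l ?c_ge0.
Qed.

(** The exceptional set is the union over [i] of the events that [tau] stays at least [1/(i+1)] at
    every level. Each event is contained in all its single-level events, whose probabilities get
    arbitrarily small. *)
Lemma tau_vanishes : exists Om0 : set (g_sigma_algebraType (@cylinders n)),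
  [/\ measurable Om0, nu Om0 = 1%E &
    forall om, Om0 om -> forall e, 0 < e -> exists k, tau (mkseq om k) < e].
Proof.
pose N i := \bigcap_k large_at i.+1%:R^-1 k.
have mN i : measurable (N i).
  by apply: bigcapT_measurable => k; exact: large_at_measurable.
have N0 i : nu (N i) = 0%E.
  apply/eqP; rewrite eq_le measure_ge0 andbT; apply/lee_addgt0Pr => e e0.
  have i0 : 0 < i.+1%:R^-1 :> R by rewrite invr_gt0.
  have [k hk] := mean_small (mulr_gt0 e0 i0).
  rewrite add0e; apply: (@le_trans _ _ (nu (large_at i.+1%:R^-1 k))).
    apply: le_measure; rewrite ?inE//; first exact: large_at_measurable.
    by move=> om; apply.
  apply: le_trans (large_at_le k i0) _.
  by rewrite lee_fin ler_pdivrMr// ltW.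
have mU : measurable (\bigcup_i N i) by exact: bigcup_measurable.
have U0 : nu (\bigcup_i N i) = 0%E.
  apply/negligibleP => //; apply: negligible_bigcup => i.
  by apply/negligibleP; [exact: mN|exact: N0].
exists (~` \bigcup_i N i); split; first exact: measurableC.
  by rewrite probability_setC// U0 sube0.
move=> om hom e e0; apply: contrapT => /forallNP h; apply: hom.
have := archi_boundP (ltW (divr_gt0 ltr01 e0)); set i := Num.bound _ => hi.
exists i => // k _; rewrite /large_at /=.
apply: le_trans (_ : e <= _); last by rewrite leNgt; apply/negP/h.
rewrite -[leRHS]invrK lef_pV2 ?posrE ?invr_gt0// -[e^-1]mul1r (le_trans (ltW hi))//.
by rewrite ler_nat.
Qed.

End PathMeasure.

(** * Cylinder probabilities and the almost sure frame expansion *)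

Lemma cyl_prob_rcons (R : realType) (V : lmodType R[i]) (ip : V -> V -> R[i]) (m : nat)
    (P : 'I_m -> V -> V) (R0 : V -> V) (q : 'I_m -> R) w j :
  cyl_prob ip P R0 q (rcons w j) = cyl_prob ip P R0 q w * p_tr ip P R0 q w j.
Proof.
(* A product over natural numbers lets the last factor split off; the default [j] of [nth] is never
   reached, as [i < size v]. *)
have E v : cyl_prob ip P R0 q v =
    \prod_(0 <= i < size v) p_tr ip P R0 q (take i v) (nth j v i).
  by rewrite big_mkord; apply: eq_bigr => i _; rewrite (tnth_nth j).
rewrite !E size_rcons big_nat_recr//= -cats1 take_size_cat// nth_cat ltnn subnn /=.
congr (_ * _); apply: eq_big_nat => i /andP[_ iw].
by rewrite takel_cat ?(ltnW iw)// nth_cat iw.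
Qed.

Theorem theorem7p3 (R : realType) (V : lmodType R[i]) (ip : V -> V -> R[i])
  (n : nat) (P : 'I_n.+2 -> V -> V) (R0 : V -> V) (q : 'I_n.+2 -> R)
  (nu : probability (g_sigma_algebraType (@cylinders n)) R)
  (Rset : (nat -> 'I_n.+2) -> nat -> set nat)
  (u : (nat -> 'I_n.+2) -> nat -> nat -> V)
  (lam : (nat -> 'I_n.+2) -> nat -> nat -> R) :
  separable_hilbert ip ->
  (forall j, orth_proj ip (P j)) ->
  positive_op ip R0 ->
  trace_class_pos ip R0 ->
  leakage ip P R0 ->
  (forall j, 0 < q j < 1) -> \sum_(j < n.+2) q j = 1 ->
  (forall w : seq 'I_n.+2, nu (cyl w) = (cyl_prob ip P R0 q w)%:E) ->
  (forall om k, (1 <= k)%N ->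
     [/\ orthonormal_on ip (Rset om k) (u om k),
         forall r, Rset om k r -> 0 <= lam om k r
       & forall x, vcvg ip
           (fun N => \sum_(0 <= r < N | r \in Rset om k)
                       (lam om k r)%:C%C *: (ip x (u om k r) *: u om k r))
           (Delta ip P R0 om k x)]) ->
  exists Om0 : set (g_sigma_algebraType (@cylinders n)),
    [/\ measurable Om0, nu Om0 = 1%E &
    forall om, Om0 om ->
    let phi k r := (Num.sqrt (lam om k r))%:C%C *: u om k r in
    let idx := [set kr : nat * nat | (1 <= kr.1)%N /\ Rset om kr.1 kr.2] in
    [/\ (* (1) *)
        forall x, vcvg ip (fun N => \sum_(1 <= k < N.+1) Delta ip P R0 om k x) (R0 x),
        (* (2) *)
        forall x,
          [/\ ccvg (fun N => \sum_(1 <= k < N.+1) ip x (Delta ip P R0 om k x))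
                   (ip x (R0 x)),
              forall N, \sum_(1 <= k < N.+1) ip x (Delta ip P R0 om k x)
                        <= \sum_(1 <= k < N.+2) ip x (Delta ip P R0 om k x)
            & forall k, (1 <= k)%N ->
                ccvg (fun N => \sum_(0 <= r < N | r \in Rset om k)
                                 ((cabs (ip x (phi k r))) ^+ 2)%:C%C)
                     (ip x (Delta ip P R0 om k x))],
        (* (3) *)
        hclosure ip (lin_span [set phi kr.1 kr.2 | kr in idx])
          = hclosure ip (range (opsqrt ip R0)) /\
        (forall x, (\esum_(kr in idx) ((cabs (ip x (phi kr.1 kr.2))) ^+ 2)%:E)%E
                   = (complex.Re (ip x (R0 x)))%:E)
      & (* Parseval case *)
        orth_proj ip R0 ->
          hclosure ip (lin_span [set phi kr.1 kr.2 | kr in idx]) = range R0 /\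
          (forall x, range R0 x ->
             (\esum_(kr in idx) ((cabs (ip x (phi kr.1 kr.2))) ^+ 2)%:E)%E
               = ((hnorm ip x) ^+ 2)%:E)]].
Proof.
move=> [ipA cV _] oP pR0 [_ fR0] [alpha [a0 hl]] q01 _ nuE spec.
have decay := p_tr_decay ipA cV oP pR0 fR0 (ltn0Sn n.+1) a0 hl
  (fun j => ltW (proj1 (andP (q01 j)))).
have d0 : 0 < alpha / n.+2%:R by rewrite divr_gt0.
(* The word function is the trace of [R_w], with decay rate [alpha / m] and [m = n + 2]. *)
have [Om0 [mO nuO hO]] := tau_vanishes nuE (@cyl_prob_rcons _ _ ip _ P R0 q)
  (fun w => tr_ge0 (Rw ip P R0 w)) d0 decay.
exists Om0; split=> // om /hO small phi idx.
have ou k k1 := let: And3 h _ _ := spec om k k1 in h.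
have l0 k k1 := let: And3 _ h _ := spec om k k1 in h.
have sp k k1 := let: And3 _ _ h := spec om k k1 in h.
have span := frame_closed_span ipA cV oP pR0 fR0 small ou l0 sp.
have parseval := frame_esum ipA cV oP pR0 fR0 small l0 sp.
split=> //.
- exact: sum_Delta_cvg.
- move=> x; split; [exact: sum_ip_Delta_cvg|exact: sum_ip_Delta_nd|].
  by move=> k k1; exact: (frame_level_ccvg ipA cV oP pR0 l0 sp).
- move=> oR0; have [pS SS] := opsqrtP ipA cV pR0; split.
    by rewrite span; exact (range_closure_orth_proj ipA oR0 pS SS).
  (* On its range the projection is the identity, so [<x, R_0 x>] is [||x||^2]. *)
  move=> x [y _ xE]; rewrite parseval (hnorm_sqr ipA).
  by rewrite -xE; case: oR0 => _ -> _.
Qed.
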